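(* Let $p_T$ be the critical probability of bond percolation on the iterated barycentric subdivision $T$ of a triangle, as defined in the context. Then $p_T<0.282$.
   Context: Barycentric subdivision: a triangle with vertices $x,y,z$ is subdivided into the six triangles $\{x,m_{xy},c\},\{m_{xy},y,c\},\{y,m_{yz},c\},\{m_{yz},z,c\},\{z,m_{zx},c\},\{m_{zx},x,c\}$, where $m_{uv}$ is the midpoint of side $uv$ and $c=(x+y+z)/3$. Let $T_0$ be an equilateral triangle with vertices $v_0,v_1,v_2$ and let $T_n$ be obtained by subdividing every triangular face of $T_{n-1}$. As a graph, $T_n$ has as vertices all vertices of this triangulation and as edges the sides of its $6^n$ faces. Bond percolation with parameter $p$: each edge receives an i.i.d. uniform $[0,1]$ label $\omega(e)$ and is open if $\omega(e)<p$. The limit $T$ has vertices of infinite degree, so its critical probability is defined through crossings: $p_T=\sup\{p\in[0,1]:\mathbb{P}_p(\text{there is an open path from } v_0 \text{ to } v_1 \text{ in } T_n)\to 0 \text{ as } n\to\infty\}$. *)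

(* Defs.v *)
From HB Require Import structures.
From mathcomp Require Import all_boot all_order all_algebra.
From mathcomp Require Import finmap.
From mathcomp Require Import all_classical all_reals all_analysis.
Set Implicit Arguments. Unset Strict Implicit. Unset Printing Implicit Defensive.
Import Order.TTheory GRing.Theory Num.Theory.
Import numFieldNormedType.Exports.
Local Open Scope classical_set_scope.
Local Open Scope ring_scope.

(* Points of the plane, in (exact, rational) barycentric coordinates with   *)
(* respect to the vertices v0, v1, v2 of the triangle T_0.  Midpoints and   *)
(* centroids are affine notions, so this encodes the subdivision exactly.  *)
Definition pt : Type := (rat * rat * rat)%type.

Definition v0 : pt := (1, 0, 0).
Definition v1 : pt := (0, 1, 0).
Definition v2 : pt := (0, 0, 1).

Definition ptadd (a b : pt) : pt := (a.1.1 + b.1.1, a.1.2 + b.1.2, a.2 + b.2).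
Definition ptscale (k : rat) (a : pt) : pt := (k * a.1.1, k * a.1.2, k * a.2).

Definition midpt (u v : pt) : pt := ptscale (1/2) (ptadd u v).
Definition centroid (x y z : pt) : pt := ptscale (1/3) (ptadd (ptadd x y) z).

Definition face : Type := (pt * pt * pt)%type.

Definition subdiv (f : face) : seq face :=
  let: (x, y, z) := f in
  let c := centroid x y z in
  let mxy := midpt x y in let myz := midpt y z in let mzx := midpt z x in
  [:: (x, mxy, c); (mxy, y, c); (y, myz, c); (myz, z, c); (z, mzx, c); (mzx, x, c)].

Fixpoint faces (n : nat) : seq face :=
  if n is n'.+1 then flatten (map subdiv (faces n')) else [:: (v0, v1, v2)].

Definition edges (n : nat) : seq {fset pt} :=
  undup (flatten [seq let: (x, y, z) := f in
                      [:: [fset x; y]%fset; [fset y; z]%fset; [fset z; x]%fset]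
                 | f <- faces n]).

Definition nedges (n : nat) : nat := size (edges n).

Definition adj (n : nat) (O : {set 'I_(nedges n)}) (a b : pt) : bool :=
  [exists i in O, nth fset0 (edges n) i == [fset a; b]%fset].

Definition crossing (n : nat) (O : {set 'I_(nedges n)}) (x y : pt) : Prop :=
  exists s : seq pt, path (adj O) x s && (last x s == y).

Definition crossprob (R : realType) (n : nat) (p : R) : R :=
  \sum_(O : {set 'I_(nedges n)})
     p ^+ #|O| * (1 - p) ^+ (nedges n - #|O|) * (asbool (crossing O v0 v1))%:R.

Definition pT (R : realType) : R :=
  sup [set p : R | 0 <= p <= 1 /\ crossprob n p @[n --> \oo] --> (0 : R)].

(* Main.v *)
Require Import Defs.
From Stdlib Require Import NArith Lia.
From HB Require Import structures.
From mathcomp Require Import all_boot all_order all_algebra.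
From mathcomp Require Import finmap lra ring zify.
From mathcomp Require Import all_classical all_reals all_analysis.
Set Implicit Arguments. Unset Strict Implicit. Unset Printing Implicit Defensive.
Import Order.TTheory GRing.Theory Num.Theory.

(** If each edge of T_n is open with probability p >= 1 - (1 - s)^2, then, every
edge lying in at most two faces, the open graph dominates the one in which
every side of every face is independently open with probability s.  In this
second model the 6^k faces of T_k carry independent copies of percolation on
T_(n-k), so the random partition that percolation induces on a few terminals
of a triangle can be bounded from below recursively, through its integrals
against functions that increase with connectivity.

Take s = 2501/16384, so that 1 - (1 - s)^2 < 0.282, and consider the partition
of the three corners and three midpoints of sides.  Cut a triangle subdivided
n+1 times into three kites, each the union of the two faces at a corner, which
are glued at the corners and midpoints of their sides only.  A computation
starting from the edges of a kite subdivided twice gives a law D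
which bounds the partition law of T_3 from below, and such that if D is a
lower bound for T_n then it is one for T_(n+1).  Hence the probability of
a crossing is bounded away from 0 for all p >= 1 - (1 - s)^2. *)

(** * Expectations over independent edges *)

Local Open Scope ring_scope.

(** Mean of [G] over the random subsequence of [l] that keeps each entry independently with
    probability [s]. With recursion on the list, independence of two pieces becomes an identity
    about [++], see [expect_cat]. *)
Fixpoint expect (R : realFieldType) (A : Type) (s : R) (l : seq A) (G : seq A -> R) : R :=
  if l is e :: l' then s * expect s l' (fun g => G (e :: g)) + (1 - s) * expect s l' G
  else G [::].

Section Expectation.
Variables (R : realFieldType) (s : R).
Hypotheses (s0 : 0 <= s) (s1 : s <= 1).

Lemma expect_le (A : Type) (l : seq A) (G H : seq A -> R) :
  (forall g, G g <= H g) -> expect s l G <= expect s l H.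
Proof.
elim: l G H => [|e l IH] G H GH /=; first exact: GH.
apply: lerD; apply: ler_wpM2l => //; try (by rewrite subr_ge0);
  by apply: IH => g; apply: GH.
Qed.

Lemma expect_ext (A : Type) (l : seq A) (G H : seq A -> R) :
  G =1 H -> expect s l G = expect s l H.
Proof.
by elim: l G H => [|e l IH] G H GH /=; [exact: GH | congr (_ * _ + _ * _); apply: IH => g; apply: GH].
Qed.

Lemma expect_cst (A : Type) (l : seq A) c : expect s l (fun _ => c) = c.
Proof. by elim: l => //= e l ->; ring. Qed.

Lemma expect_lin (A : Type) (l : seq A) a b (G H : seq A -> R) :
  expect s l (fun g => a * G g + b * H g) = a * expect s l G + b * expect s l H.
Proof. by elim: l G H => //= e l IH G H; rewrite !IH; ring. Qed.

Lemma expect_ge0 (A : Type) (l : seq A) (G : seq A -> R) :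
  (forall g, 0 <= G g) -> 0 <= expect s l G.
Proof. by move=> G0; rewrite -(expect_cst l 0); apply: expect_le. Qed.

Lemma expect_cat (A : Type) (l1 l2 : seq A) (G : seq A -> R) :
  expect s (l1 ++ l2) G = expect s l1 (fun g1 => expect s l2 (fun g2 => G (g1 ++ g2))).
Proof. by elim: l1 G => //= e l1 IH G; rewrite !IH. Qed.

Lemma expect_map (A B : Type) (f : A -> B) (l : seq A) (G : seq B -> R) :
  expect s (map f l) G = expect s l (fun g => G (map f g)).
Proof. by elim: l G => //= e l IH G; rewrite !IH. Qed.

Definition submono (A : eqType) (G : seq A -> R) :=
  forall g h : seq A, {subset g <= h} -> G g <= G h.

Lemma submono_eq (A : eqType) (G : seq A -> R) (g h : seq A) :
  submono G -> g =i h -> G g = G h.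
Proof.
by move=> mG gh; apply: le_anti; rewrite !mG // => e; rewrite gh.
Qed.

Lemma submono_cons (A : eqType) (G : seq A -> R) e :
  submono G -> submono (fun g => G (e :: g)).
Proof.
move=> mG g h gh; apply: mG => f; rewrite !inE => /orP[->//|/gh ->].
by rewrite orbT.
Qed.

Lemma expect_perm (A : eqType) (l l' : seq A) (G : seq A -> R) :
  submono G -> perm_eq l l' -> expect s l G = expect s l' G.
Proof.
elim: l l' G => [|e l IH] l' G mG; first by rewrite perm_sym => /perm_nilP ->.
move=> pl.
have el' : e \in l' by rewrite -(perm_mem pl) mem_head.
case/splitPr: el' pl => l1 l2; rewrite perm_sym -cat1s perm_catCA /= perm_cons perm_sym => pl.
have -> : expect s (l1 ++ e :: l2) G = expect s (e :: l1 ++ l2) G.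
  rewrite expect_cat /= !expect_cat -expect_lin; apply: expect_ext => g1.
  congr (_ * _ + _); apply: expect_ext => g2; apply: submono_eq => // f.
  by rewrite !(inE, mem_cat) orbCA.
by rewrite /=; congr (_ * _ + _ * _); apply: IH => //; apply: submono_cons.
Qed.

End Expectation.

(* An element of multiplicity k <= 2 is selected at least once with
   probability 1 - (1 - s)^k <= p. *)
Lemma expect_undup (R : realFieldType) (A : eqType) (s p : R) (l : seq A) (G : seq A -> R) :
  0 <= s -> s <= 1 -> 1 - (1 - s) ^+ 2 <= p -> p <= 1 ->
  (forall e, count_mem e l <= 2)%N -> submono G ->
  expect s l G <= expect p (undup l) G.
Proof.
move=> s0 s1 sp p1.
have p0 : 0 <= p by apply: le_trans sp; nra.
have [n] := ubnP (size l); elim: n l G => // n IH [|a l] // G ln cl mG.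
pose k := count_mem a (a :: l); pose l' := [seq e <- l | e != a].
have pl : perm_eq (a :: l) (nseq k a ++ l').
  rewrite /k -size_filter; have /all_pred1P <- := filter_all (pred1 a) (a :: l).
  have -> : l' = [seq e <- a :: l | predC (pred1 a) e] by rewrite /= eqxx.
  by rewrite perm_sym perm_filterC.
have pu : perm_eq (undup (a :: l)) (a :: undup l').
  apply: uniq_perm; first exact: undup_uniq.
    by rewrite cons_uniq undup_uniq mem_undup mem_filter eqxx.
  move=> e; rewrite mem_undup !inE mem_undup mem_filter.
  by case: eqP.
rewrite (expect_perm _ mG pu) (expect_perm _ mG pl) expect_cat /=.
have IH' H : submono H -> expect s l' H <= expect p (undup l') H.
  apply: IH => [|e].
    rewrite ltnS /= in ln; apply: leq_ltn_trans ln; rewrite size_filter.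
    exact: count_size.
  apply: leq_trans (cl e); rewrite /= count_filter.
  apply: leq_trans (leq_addl _ _); apply: sub_count => x /= /andP[]//.
have lea : expect s l' G <= expect s l' (fun g => G (a :: g)).
  by apply: expect_le => // g; apply: mG => e; rewrite inE => ->; rewrite orbT.
(* Intermediate quantity: [a] is already kept with probability [p], while the other entries are
   still drawn from [l'] with probability [s]. *)
apply: le_trans (_ : p * expect s l' (fun g => G (a :: g)) + (1 - p) * expect s l' G <= _); last first.
  apply: lerD; apply: ler_wpM2l => //; try (by rewrite subr_ge0); apply: IH' => //.
  exact: submono_cons.
have k12 : (1 <= k <= 2)%N by rewrite cl andbT /k /= eqxx.
have E2 : expect s l' (fun g2 => G (a :: a :: g2)) = expect s l' (fun g => G (a :: g)).
  by apply: expect_ext => g; apply: submono_eq => // e; rewrite !inE orbA orbb.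
case: k {pl} k12 => [|[|[|]]] // _ /=; rewrite ?E2;
  move: (expect s l' _) (expect s l' _) lea => X Y lea.
  have sp' : s <= p by nra.
  have := mulr_ge0 (_ : 0 <= p - s) (_ : 0 <= Y - X); nra.
have := mulr_ge0 (_ : 0 <= p - (1 - (1 - s) ^+ 2)) (_ : 0 <= Y - X); nra.
Qed.

(** * Connectivity of graphs given by lists of edges *)

Section Connectivity.
Variables (V : eqType).

Inductive conn (g : seq (V * V)) : V -> V -> Prop :=
| conn_refl a : conn g a a
| conn_step a b c : ((a, b) \in g) || ((b, a) \in g) -> conn g b c -> conn g a c.

Lemma conn_trans g b a c : conn g a b -> conn g b c -> conn g a c.
Proof. by elim=> // {}a {}b d ab _ IH /IH; apply: conn_step. Qed.

Lemma conn1 g a b : (a, b) \in g -> conn g a b.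
Proof. by move=> ab; apply: conn_step (conn_refl _ _); rewrite ab. Qed.

Lemma conn_sym g a b : conn g a b -> conn g b a.
Proof.
elim=> [{}a|{}a {}b c ab _ bc]; first exact: conn_refl.
apply: conn_trans bc _; apply: conn_step (conn_refl _ _); by rewrite orbC.
Qed.

(** Graphs are compared through the partitions they induce, so lists with the same components are
    equivalent. *)
Definition le_conn (g h : seq (V * V)) := forall e, e \in g -> conn h e.1 e.2.

Lemma le_conn_conn g h a b : le_conn g h -> conn g a b -> conn h a b.
Proof.
move=> gh; elim=> [{}a|{}a {}b c /orP[]/gh /= ab _ bc]; first exact: conn_refl.
  exact: conn_trans bc.
by apply: conn_trans bc; apply: conn_sym.
Qed.

Lemma sub_le_conn (g h : seq (V * V)) : {subset g <= h} -> le_conn g h.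
Proof. by move=> gh [a b] /gh; apply: conn1. Qed.

Lemma le_conn_refl g : le_conn g g. Proof. exact: sub_le_conn. Qed.

Lemma le_conn_trans h g k : le_conn g h -> le_conn h k -> le_conn g k.
Proof. by move=> gh hk e /gh; apply: le_conn_conn. Qed.

Lemma le_conn_cat g g' h h' :
  le_conn g h -> le_conn g' h' -> le_conn (g ++ g') (h ++ h').
Proof.
move=> gh gh' e; rewrite mem_cat => /orP[/gh|/gh']; apply: le_conn_conn;
  by apply: sub_le_conn => f fh; rewrite mem_cat fh ?orbT.
Qed.

Lemma le_conn_catl g h : le_conn g (g ++ h).
Proof. by apply: sub_le_conn => e eg; rewrite mem_cat eg. Qed.

Variable R : realFieldType.

(** The test functions against which partition laws are compared. Nonnegativity makes it harmless to
    drop mass. *)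
Definition mono (G : seq (V * V) -> R) :=
  (forall g, 0 <= G g) /\ (forall g h, le_conn g h -> G g <= G h).

Lemma mono_submono G : mono G -> submono G.
Proof. by move=> [_ mG] g h /sub_le_conn /mG. Qed.

Lemma mono_eq G g h : mono G -> le_conn g h -> le_conn h g -> G g = G h.
Proof. by move=> [_ mG] gh hg; apply: le_anti; rewrite !mG. Qed.

Lemma mono_catl G h : mono G -> mono (fun g => G (h ++ g)).
Proof.
move=> [G0 mG]; split=> [g|g g' gg']; first exact: G0.
by apply/mG/le_conn_cat => //; apply: le_conn_refl.
Qed.

(** Averaging over one independent part leaves an admissible test function of the other part, which
    is what lets laws be composed. *)
Lemma mono_expect G s l : 0 <= s -> s <= 1 ->
  mono G -> mono (fun g => expect s l (fun g' => G (g ++ g'))).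
Proof.
move=> s0 s1 [G0 mG]; split=> [g|g g' gg']; first by apply: expect_ge0.
by apply: expect_le => // h; apply/mG/le_conn_cat => //; apply: le_conn_refl.
Qed.

End Connectivity.

(** * Laws of partitions as tries *)

Local Open Scope nat_scope.

Inductive trie := Nil | Leaf of N | Bin of trie & trie.

Definition here t := if t is Bin h _ then h else Nil.
Definition next t := if t is Bin _ n then n else Nil.
Definition leaf t := if t is Leaf w then w else N0.

Fixpoint ins (key : seq nat) (w : N) (t : trie) {struct key} : trie :=
  match key with
  | [::] => Leaf (N.add (leaf t) w)
  | k :: r =>
    (fix go (k : nat) (t : trie) {struct k} : trie :=
      match k with
      | 0 => Bin (ins r w (here t)) (next t)
      | k'.+1 => Bin (here t) (go k' (next t))
      end) k t
  end.

Definition ins_nz key w t := if w is N0 then t else ins key w t.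

(* In a trie a path spells a partition, given by the labels of the blocks of
   the successive terminals; label k is coded by k steps to the right and one
   to the left. *)
Fixpoint elems (t : trie) (pre : seq nat) (k : nat) (tl : seq (seq nat * N)) :=
  match t with
  | Nil => tl
  | Leaf w => (rev pre, w) :: tl
  | Bin h n => elems h (k :: pre) 0 (elems n pre k.+1 tl)
  end.

Definition entries t := elems t [::] 0 [::].

Definition tfold (f : seq nat -> N -> trie -> trie) t :=
  foldl (fun acc p => f p.1 p.2 acc) Nil (entries t).

Fixpoint total t :=
  match t with Nil => N0 | Leaf w => w | Bin a b => N.add (total a) (total b) end.

Fixpoint tle t1 t2 :=
  match t1, t2 with
  | Nil, _ => true
  | Leaf w, Leaf w' => N.leb w w'
  | Bin a b, Bin a' b' => tle a a' && tle b b'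
  | _, _ => false
  end.

Fixpoint relabel m M (st : seq nat) :=
  if st is x :: r then
    (match Nat.compare x M with Lt => x | Eq => m | Gt => x.-1 end) :: relabel m M r
  else [::].

(** Canonical labels stay canonical: the surviving smaller label belongs to the block whose last
    element comes later, and [relabel] closes the gap left by the larger one. *)
Definition merge i j st :=
  let a := nth 0 st i in let b := nth 0 st j in
  match Nat.compare a b with
  | Eq => st | Lt => relabel a b st | Gt => relabel b a st
  end.

Fixpoint merges (ps : seq (nat * nat)) st :=
  if ps is (i, j) :: r then merges r (merge i j st) else st.

Fixpoint label_pos (x : nat) (l : seq nat) : nat :=
  if l is y :: r then
    match Nat.compare x y with Eq => 0 | _ => (label_pos x r).+1 end
  else 0.

(* Blocks are renumbered in the order of their last elements, so that a fresh
   block can be put in front without renumbering; the first component lists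
   the old labels in this order. *)
Fixpoint canon_env (st : seq nat) : seq nat * seq nat :=
  if st is x :: r then
    let: (env, r') := canon_env r in
    let p := label_pos x env in
    ((if Nat.compare p (size env) is Lt then env else rcons env x), p :: r')
  else ([::], [::]).
Definition canon st := (canon_env st).2.

Fixpoint rm (i : nat) (st : seq nat) :=
  match st, i with
  | [::], _ => [::] | _ :: r, 0 => r | x :: r, i'.+1 => x :: rm i' r
  end.

Fixpoint fresh (st : seq nat) : nat :=
  if st is x :: r then maxn x.+1 (fresh r) else 0.

Fixpoint setat (i f : nat) (st : seq nat) :=
  match st, i with
  | [::], _ => [::] | _ :: r, 0 => f :: r | x :: r, i'.+1 => x :: setat i' f r
  end.

Definition isolate i st := canon (setat i (fresh st) st).

Fixpoint extend k st := if k is k'.+1 then extend k' (fresh st :: st) else st.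

Fixpoint assoc (x : nat) (e : seq (nat * nat)) :=
  if e is (y, p) :: r then
    match Nat.compare x y with Eq => Some p | _ => assoc x r end
  else None.

(** A star inside each block of [key]: the position of its first terminal, remembered in [e], is
    paired with that of each later one. *)
Fixpoint pairs (key ps : seq nat) (e : seq (nat * nat)) :=
  match key, ps with
  | x :: key', p :: ps' =>
    if assoc x e is Some f then (f, p) :: pairs key' ps' e
    else pairs key' ps' ((x, p) :: e)
  | _, _ => [::]
  end.

(* Module weights are cut from 26 to 18 bits to make products cheaper. *)
Definition compile (t : trie) (ps : seq nat) :=
  [seq (pairs p.1 ps [::], N.shiftr p.2 8)
  | p <- entries t & (size p.1 == size ps) && N.ltb 255 p.2].

Fixpoint addmod (M : seq (seq (nat * nat) * N)) st w acc :=
  if M is (ps, q) :: M' then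
    addmod M' st w (ins_nz (merges ps st) (N.shiftr (N.mul q w) 18) acc)
  else acc.

(** The names of the live terminals, and the law of their partition; labels in a state follow the
    order of the names. *)
Definition dist := (seq nat * trie)%type.

Fixpoint addnames (ts ns : seq nat) :=
  if ts is a :: ts' then addnames ts' (if a \in ns then ns else a :: ns) else ns.

(** Glues on an independent piece with law [t] at the terminals [ts]: new terminals enter as
    singletons, then every state is joined with every partition of the piece, and weights
    multiply. *)
Definition mod_step t ts (p : dist) : dist :=
  let ns' := addnames ts p.1 in
  let M := compile t [seq index a ns' | a <- ts] in
  let k := size ns' - size p.1 in
  (ns', tfold (fun st w acc => addmod M (extend k st) w acc) p.2).

(* 2501/2^14 is the opening probability of a side; 2310/2^13 is just below
   that of a double side. *)
Definition edge_weight (d : bool) w :=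
  if d then N.shiftr (N.mul 2310 w) 13 else N.shiftr (N.mul 2501 w) 14.

Definition edge_step (d : bool) a b (p : dist) : dist :=
  let ns' := addnames [:: a; b] p.1 in
  let i := index a ns' in let j := index b ns' in
  let k := size ns' - size p.1 in
  (ns', tfold (fun st w acc =>
          let st := extend k st in
          let o := edge_weight d w in
          ins_nz st (N.sub w o) (ins (merge i j st) o acc)) p.2).

(** A state of the wrong length is sent to the empty key, which stands for the graph without
    edges. *)
Definition free a (p : dist) : dist :=
  let i := index a p.1 in let n := size p.1 in
  (rm i p.1,
   tfold (fun st w acc =>
     ins (if size st == n then canon (rm i st) else [::]) w acc) p.2).

Fixpoint frees (keep : pred nat) l p :=
  if l is a :: l' then frees keep l' (if keep a then p else free a p) else p.

(* Replacing states of small weight by finer ones keeps the supports small. *)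
Fixpoint prunes eps k t :=
  if k is k'.+1 then
    prunes eps k' (tfold (fun st w acc =>
      ins (if N.ltb w eps then isolate k' st else st) w acc) t)
  else t.
Definition prune eps (p : dist) : dist := (p.1, prunes eps (size p.1) p.2).

Definition reorder (ts : seq nat) (p : dist) : trie :=
  let ps := [seq index a p.1 | a <- ts] in let n := size p.1 in
  if all (mem p.1) ts then
    tfold (fun st w acc =>
      ins (if size st == n then canon [seq nth 0 st i | i <- ps] else [::]) w acc) p.2
  else Nil.

Definition refines (g f : seq nat) :=
  (size g == size f) &&
  all (fun i => all (fun j => (nth 0 g i == nth 0 g j) ==> (nth 0 f i == nth 0 f j))
    (iota 0 (size f))) (iota 0 (size f)).

(** Moving weight to a finer partition lowers all integrals of increasing functions. The test
    [refines] and the minimum with [w] make this sound for arbitrary data. *)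
Definition move (f g : seq nat) m t :=
  if refines g f then
    tfold (fun st w acc =>
      if st == f then ins st (N.sub w (N.min m w)) (ins g (N.min m w) acc)
      else ins st w acc) t
  else t.

Definition moves (l : seq (seq nat * seq nat * N)) t :=
  foldr (fun x => move x.1.1 x.1.2 x.2) t l.

Definition strip t := tfold (fun st w acc => if uniq st then acc else ins st w acc) t.

(* The weight standing for probability 1. *)
Definition unit_mass : N := 67108864.
Definition start : dist := ([::], Leaf unit_mass).

(** The frontier method: a terminal is forgotten once it is neither an output nor an end of a
    remaining edge, so few partitions are stored at any time. *)
Fixpoint run_edges (out : seq nat) (es : seq (nat * nat * bool)) (p : dist) : dist :=
  if es is (a, b, d) :: es' then
    let p' := edge_step d a b p in
    let keep x := (x \in out) || has (fun e => (x == e.1.1) || (x == e.1.2)) es' in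
    run_edges out es' (frees keep p'.1 p')
  else p.

Fixpoint run_mods (out : seq nat) eps (ms : seq (trie * seq nat)) (p : dist) : dist :=
  if ms is (t, ts) :: ms' then
    let p' := mod_step t ts p in
    let keep x := (x \in out) || has (fun m => x \in m.2) ms' in
    run_mods out eps ms' (prune eps (frees keep p'.1 p'))
  else p.

Definition refill bot t := ins bot (N.sub unit_mass (total t)) t.

(** * Operations on labellings *)

Local Open Scope nat_scope.

Lemma elems_cat t pre k tl : elems t pre k tl = elems t pre k [::] ++ tl.
Proof.
elim: t pre k tl => //= h IHh n IHn pre k tl.
by rewrite IHh IHn catA -IHh.
Qed.

Lemma compareP a b : Nat.compare a b = (if a < b then Lt else if a == b then Eq else Gt).
Proof. by elim: a b => [|a IH] [|b] //=; rewrite IH ltnS eqSS. Qed.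

Lemma nth_relabel m M st i : m < M ->
  nth 0 (relabel m M st) i =
  (let x := nth 0 st i in if x < M then x else if x == M then m else x.-1).
Proof.
move=> mM; have M0 : 0 < M by lia.
elim: st i => [|x st IH] [|i]; rewrite /= ?M0 //.
by rewrite compareP; case: ltngtP.
Qed.

Lemma size_relabel m M st : size (relabel m M st) = size st.
Proof. by elim: st => //= x st ->. Qed.

Lemma size_merge i j st : size (merge i j st) = size st.
Proof. by rewrite /merge; case: Nat.compare; rewrite ?size_relabel. Qed.

Lemma nth_relabel_eq m M st u v : m < M ->
  nth 0 (relabel m M st) u = nth 0 (relabel m M st) v ->
  let x := nth 0 st u in let y := nth 0 st v in
  [\/ x = y, x = m /\ y = M | x = M /\ y = m].
Proof.
move=> mM; rewrite !nth_relabel //= => H.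
have : [|| nth 0 st u == nth 0 st v, (nth 0 st u == m) && (nth 0 st v == M)
  | (nth 0 st u == M) && (nth 0 st v == m)].
  by move: H; case: (ltngtP (nth 0 st u) M); case: (ltngtP (nth 0 st v) M); lia.
case/or3P=> [/eqP|/andP[/eqP ? /eqP ?]|/andP[/eqP ? /eqP ?]]; first by constructor 1.
  by constructor 2.
by constructor 3.
Qed.

(** No connection appears beyond the union of the two blocks. This inclusion suffices for lower
    bounds, which losing connections would only weaken. *)
Lemma merge_eq i j st u v :
  nth 0 (merge i j st) u = nth 0 (merge i j st) v ->
  let x := nth 0 st in
  [\/ x u = x v, x u = x i /\ x v = x j | x u = x j /\ x v = x i].
Proof.
rewrite /merge compareP.
case: ltngtP => [lt|gt|eq]; last by constructor 1.
  by move/(nth_relabel_eq lt).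
by case/(nth_relabel_eq gt) => ?; [constructor 1|constructor 3|constructor 2].
Qed.

Lemma size_canon_env st : size (canon_env st).2 = size st.
Proof. by elim: st => //= x st; case: canon_env => env r /= ->. Qed.

Lemma label_pos_le x l : label_pos x l <= size l.
Proof. by elim: l => //= y l IH; rewrite compareP; case: ltngtP. Qed.

Lemma nth_label_pos x l : label_pos x l < size l -> nth 0 l (label_pos x l) = x.
Proof.
elim: l => //= y l IH; rewrite compareP.
by case: (ltngtP x y) => [_|_|->] //= /IH.
Qed.

Lemma canon_envP st i : i < size st ->
  let: (env, r) := canon_env st in
  nth 0 r i < size env /\ nth 0 env (nth 0 r i) = nth 0 st i.
Proof.
elim: st i => //= x st IH i.
have := size_canon_env st.
case: canon_env IH => env r /= IH sr.
have Lle := label_pos_le x env; rewrite compareP.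
have [L|L|L] := ltngtP (label_pos x env) (size env); last 1 first.
- case: i => [_|i] /=; first by rewrite size_rcons L leqnn nth_rcons ltnn eqxx.
  by rewrite ltnS => /IH[lt eq]; rewrite size_rcons nth_rcons lt eq ltnS ltnW.
- case: i => [_|i] /=; first by rewrite nth_label_pos.
  by rewrite ltnS => /IH.
- by rewrite ltnNge Lle in L.
Qed.

Lemma size_canon st : size (canon st) = size st.
Proof. exact: size_canon_env. Qed.

Lemma canon_eq st i j : i < size st -> j < size st ->
  nth 0 (canon st) i = nth 0 (canon st) j -> nth 0 st i = nth 0 st j.
Proof.
rewrite /canon => /canon_envP + /canon_envP; case: canon_env => env r /=.
by move=> [_ <-] [_ <-] ->.
Qed.

Lemma size_rm i st st' : size st = size st' -> size (rm i st) = size (rm i st').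
Proof.
elim: st st' i => [|x st IH] [|y st'] [|i] //= [] // e.
by congr _.+1; apply: IH.
Qed.

Lemma nth_rm i st u : nth 0 (rm i st) u = nth 0 st (bump i u).
Proof.
elim: st i u => [|x st IH] i u; first by case: i => [|i]; rewrite /= !nth_nil.
by case: i u => [|i] [|u]; rewrite ?bumpS //= IH.
Qed.

Lemma bump_rm_lt i (st : seq nat) u : u < size (rm i st) -> bump i u < size st.
Proof.
elim: st i u => [|x st IH] i u; first by case: i.
by case: i u => [|i] [|u]; rewrite ?bumpS //= ltnS; apply: IH.
Qed.

Lemma fresh_gt st i : i < size st -> nth 0 st i < fresh st.
Proof.
elim: st i => //= x st IH [|i] /=; rewrite leq_max ?ltnSn // ltnS.
by move/IH => ->; rewrite orbT.
Qed.

Lemma size_setat i f st : size (setat i f st) = size st.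
Proof. by elim: st i => [|x st IH] [|i] //=; rewrite IH. Qed.

Lemma nth_setat i f st u : u < size st ->
  nth 0 (setat i f st) u = if u == i then f else nth 0 st u.
Proof. by elim: st i u => [|x st IH] [|i] [|u] //= ; rewrite ltnS eqSS => /IH. Qed.

Lemma assoc_in x e p : assoc x e = Some p -> (x, p) \in e.
Proof.
elim: e => //= -[y q] e IH; rewrite compareP inE.
case: ltngtP => [_ /IH->|_ /IH->|-> [->]]; rewrite ?orbT ?eqxx //.
Qed.

Lemma pairsP key ps e f p : (f, p) \in pairs key ps e ->
  exists v, [/\ v < size key, v < size ps, p = nth 0 ps v &
   (nth 0 key v, f) \in e \/
   exists u, [/\ u < size key, u < size ps, nth 0 key u = nth 0 key v & f = nth 0 ps u]].
Proof.
elim: key ps e => [|x key IH] [|q ps] e //=.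
have shift e' : (f, p) \in pairs key ps e' -> (forall y, (y, f) \in e' -> (y, f) \in e \/ (y = x /\ f = q)) ->
  exists v, [/\ v < (size key).+1, v < (size ps).+1, p = nth 0 (q :: ps) v &
   (nth 0 (x :: key) v, f) \in e \/
   exists u, [/\ u < (size key).+1, u < (size ps).+1, nth 0 (x :: key) u = nth 0 (x :: key) v & f = nth 0 (q :: ps) u]].
  case/IH=> v [vk vp pE H] ee; exists v.+1; split=> //=.
  case: H => [/ee[|[-> ->]]|[u [? ? ? ?]]]; first by left.
    by right; exists 0.
  by right; exists u.+1.
case E: assoc => [g|] /=; last first.
  by move/shift; apply=> y; rewrite inE => /orP[/eqP[-> ->]|]; auto.
rewrite inE => /orP[/eqP[-> ->]|/shift]; last by apply=> y; auto.
by exists 0; split=> //; left; apply: assoc_in.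
Qed.

Lemma addnamesE ts ns : exists l, addnames ts ns = l ++ ns.
Proof.
elim: ts ns => [|a ts IH] ns /=; first by exists [::].
have [l ->] := IH (if a \in ns then ns else a :: ns).
by case: ifP => _; [exists l | exists (l ++ [:: a]); rewrite -catA].
Qed.

Lemma addnames_sub ts ns a : (a \in ts) || (a \in ns) -> a \in addnames ts ns.
Proof.
elim: ts ns => //= b ts IH ns; rewrite inE => H; apply: IH.
by case: ifP => ab; rewrite ?inE; case: eqP H => [->|_] /=; rewrite ?ab ?orbT.
Qed.

(** * Soundness of the computation *)

Local Open Scope nat_scope.

Section Laws.
Variables (R : realFieldType) (V : eqType) (x0 : V).
Local Open Scope ring_scope.

Definition wt (w : N) : R := (N.to_nat w)%:R.

Lemma wt_ge0 w : 0 <= wt w. Proof. exact: ler0n. Qed.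
Lemma wtD a b : wt (N.add a b) = wt a + wt b.
Proof. by rewrite /wt N2Nat.inj_add natrD. Qed.
Lemma wtM a b : wt (N.mul a b) = wt a * wt b.
Proof. by rewrite /wt N2Nat.inj_mul natrM. Qed.
Lemma wt_le a b : N.le a b -> wt a <= wt b.
Proof. by move=> ab; rewrite ler_nat; apply/ssrnat.leP; lia. Qed.
Lemma wt_sub a b : N.le b a -> wt (N.sub a b) = wt a - wt b.
Proof. by move=> ab; rewrite -[in RHS](N.sub_add b a ab) wtD addrK. Qed.
Lemma wt_shiftr a k : wt (N.pow 2 k) * wt (N.shiftr a k) <= wt a.
Proof.
rewrite -wtM; apply: wt_le; rewrite N.shiftr_div_pow2.
by apply: N.mul_div_le; apply: N.pow_nonzero.
Qed.

Lemma wt0 : wt 0 = 0. Proof. by []. Qed.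
Lemma wt_of_nat n : wt (N.of_nat n) = n%:R.
Proof. by rewrite /wt Nat2N.id. Qed.
Lemma le_wt a b : wt a <= wt b -> N.le a b.
Proof. by rewrite ler_nat => /ssrnat.leP; lia. Qed.
Lemma wt_gt0 p : 0 < wt (Npos p).
Proof. by rewrite ltr0n; apply/ssrnat.ltP; rewrite /=; lia. Qed.
Opaque wt.

Implicit Types (phi psi : seq nat -> R) (t : trie).

(** The integral of [phi] against the weights of the trie, with the accumulators of [elems]. *)
Fixpoint tsum_at phi t pre k : R :=
  match t with
  | Nil => 0
  | Leaf w => wt w * phi (rev pre)
  | Bin h n => tsum_at phi h (k :: pre) 0%N + tsum_at phi n pre k.+1
  end.
Definition tsum phi t := tsum_at phi t [::] 0%N.

Lemma tsumE phi t : tsum phi t = \sum_(p <- entries t) wt p.2 * phi p.1.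
Proof.
rewrite /tsum /entries; elim: t [::] 0%N => [|w|h IHh n IHn] pre k /=.
- by rewrite big_nil.
- by rewrite big_seq1.
- by rewrite elems_cat big_cat -IHh -IHn.
Qed.

Lemma tsum_at_ge0 phi t pre k : (forall st, 0 <= phi st) -> 0 <= tsum_at phi t pre k.
Proof.
move=> phi0; elim: t pre k => [|w|h IHh n IHn] pre k //=.
  by rewrite mulr_ge0 ?wt_ge0.
by rewrite addr_ge0.
Qed.

(** Strict inequality is possible: inserting at a node of another shape overwrites it, and the
    weight lost is nonnegative. *)
Lemma tsum_ins phi key w t : (forall st, 0 <= phi st) ->
  tsum phi (ins key w t) <= tsum phi t + wt w * phi key.
Proof.
move=> phi0; rewrite /tsum.
(* Inside the trie, [k] steps to the right have already been made towards the next label, so the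
   first label of the remaining key is offset by [k]. *)
suff gen pre k : tsum_at phi (ins key w t) pre k <=
    tsum_at phi t pre k + wt w * phi (catrev pre (if key is x :: r then (k + x)%N :: r else [::])).
  by apply: le_trans (gen _ _) _; case: key {gen}.
elim: key t pre k => [|x key IH] t pre k /=.
  rewrite wtD mulrDl lerD2r; case: t => [|v|h n] /=; rewrite ?mul0r //.
  by rewrite addr_ge0 ?tsum_at_ge0.
elim: x t k => [|x IHx] t k /=.
  rewrite addn0; have {IH} := IH (here t) (k :: pre) 0%N.
  have -> : (if key is x :: r then (0 + x)%N :: r else [::]) = key by case: key.
  case: t => [|v|h n] /=; rewrite ?addr0 ?add0r // => IH.
    by rewrite (le_trans IH) // lerDr mulr_ge0 ?wt_ge0.
  by rewrite addrAC lerD2r.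
have {IHx} := IHx (next t) k.+1; rewrite addSnnS.
case: t => [|v|h n] /=; rewrite ?add0r // => IHx.
  by rewrite (le_trans IHx) // lerDr mulr_ge0 ?wt_ge0.
by rewrite -addrA lerD2l.
Qed.

Lemma tsum_ins_nz phi key w t : (forall st, 0 <= phi st) ->
  tsum phi (ins_nz key w t) <= tsum phi t + wt w * phi key.
Proof.
by move=> phi0; case: w => [|w]; [rewrite /= wt0 mul0r addr0 | apply: tsum_ins].
Qed.

Lemma tsum_total c t : tsum (fun _ => c) t = wt (total t) * c.
Proof.
rewrite /tsum; elim: t [::] 0%N => [|w|h IHh n IHn] pre k //=.
  by rewrite wt0 mul0r.
by rewrite IHh IHn wtD mulrDl.
Qed.

Lemma tsum_tle phi t t' : (forall st, 0 <= phi st) -> tle t t' ->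
  tsum phi t <= tsum phi t'.
Proof.
move=> phi0; rewrite /tsum; elim: t t' [::] 0%N => [|w|h IHh n IHn] [|w'|h' n'] pre k //=.
- by rewrite mulr_ge0 ?wt_ge0.
- by rewrite addr_ge0 ?tsum_at_ge0.
- by move/N.leb_le/wt_le => le; rewrite ler_wpM2r.
- by case/andP=> /IHh le1 /IHn le2; rewrite lerD.
Qed.

(** Reduces the effect of a transformation on a law to its effect on one entry. *)
Lemma tsum_tfold phi psi f t :
  (forall st w acc, tsum phi (f st w acc) <= tsum phi acc + wt w * psi st) ->
  tsum phi (tfold f t) <= tsum psi t.
Proof.
move=> step; rewrite (tsumE psi) /tfold.
suff gen l acc v : tsum phi acc <= v ->
    tsum phi (foldl (fun acc p => f p.1 p.2 acc) acc l) <=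
    v + \sum_(p <- l) wt p.2 * psi p.1.
  by have := gen (entries t) Nil 0 (lexx 0); rewrite add0r.
elim: l acc v => [|p l IH] acc v le /=; first by rewrite big_nil addr0.
rewrite big_cons addrA; apply: IH; apply: le_trans (step _ _ _) _.
by rewrite lerD2r.
Qed.

(** The partition of [xs] coded by [st], as a graph. A state of the wrong length gives the empty
    graph, the safe default for a lower bound. *)
Definition state_graph (xs : seq V) (st : seq nat) : seq (V * V) :=
  if size st == size xs then
    [seq (nth x0 xs ij.1, nth x0 xs ij.2)
    | ij <- [seq (i, j) | i <- iota 0 (size xs), j <- iota 0 (size xs)]
    & nth 0%N st ij.1 == nth 0%N st ij.2]
  else [::].

Lemma state_graphP xs st e : e \in state_graph xs st -> size st = size xs /\
  exists i j, [/\ (i < size xs)%N, (j < size xs)%N, nth 0%N st i = nth 0%N st j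
     & e = (nth x0 xs i, nth x0 xs j)].
Proof.
rewrite /state_graph; case: eqP => // sz /mapP[[i j]]; rewrite mem_filter => /andP[/= /eqP ij].
case/allpairsP=> -[i' j'] /= [+ + [ii jj]] ->; rewrite -ii -jj !mem_iota => li lj.
by split=> //; exists i, j.
Qed.

Lemma state_graph_in xs st i j : size st = size xs ->
  (i < size xs)%N -> (j < size xs)%N -> nth 0%N st i = nth 0%N st j ->
  (nth x0 xs i, nth x0 xs j) \in state_graph xs st.
Proof.
move=> sz li lj ij; rewrite /state_graph sz eqxx; apply/mapP; exists (i, j) => //.
rewrite mem_filter /= ij eqxx; apply/allpairsP; exists (i, j).
by rewrite !mem_iota /= !add0n.
Qed.

Lemma state_graph_conn xs st i j : size st = size xs ->
  (i < size xs)%N -> (j < size xs)%N -> nth 0%N st i = nth 0%N st j ->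
  conn (state_graph xs st) (nth x0 xs i) (nth x0 xs j).
Proof. by move=> sz li lj ij; apply/conn1/state_graph_in. Qed.

Lemma state_graph_uniq_le xs st g : uniq st -> le_conn (state_graph xs st) g.
Proof.
move=> ust e /state_graphP[sz [i [j [li lj /eqP + ->]]]] /=.
by rewrite nth_uniq ?sz // => /eqP ->; apply: conn_refl.
Qed.

Lemma merge_le xs st i j : (i < size xs)%N -> (j < size xs)%N ->
  le_conn (state_graph xs (merge i j st)) (state_graph xs st ++ [:: (nth x0 xs i, nth x0 xs j)]).
Proof.
move=> li lj e /state_graphP[sz [u [v [lu lv uv ->]]]] /=; rewrite size_merge in sz.
have sgc a b : (a < size xs)%N -> (b < size xs)%N -> nth 0%N st a = nth 0%N st b ->
  conn (state_graph xs st ++ [:: (nth x0 xs i, nth x0 xs j)]) (nth x0 xs a) (nth x0 xs b).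
  by move=> *; apply: le_conn_conn (@le_conn_catl _ _ _) _; apply: state_graph_conn.
have ij : conn (state_graph xs st ++ [:: (nth x0 xs i, nth x0 xs j)]) (nth x0 xs i) (nth x0 xs j).
  by apply: conn1; rewrite mem_cat inE eqxx orbT.
case: (merge_eq uv) => [uv'|[ui vj]|[uj vi]]; first exact: sgc.
  by apply: conn_trans (sgc _ _ lu li ui) (conn_trans ij _); apply: sgc.
by apply: conn_trans (sgc _ _ lu lj uj) (conn_trans (conn_sym ij) _); apply: sgc.
Qed.

Lemma merges_le xs st ps :
  (forall p, p \in ps -> (p.1 < size xs)%N /\ (p.2 < size xs)%N) ->
  le_conn (state_graph xs (merges ps st))
    (state_graph xs st ++ [seq (nth x0 xs p.1, nth x0 xs p.2) | p <- ps]).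
Proof.
elim: ps st => [|[i j] ps IH] st H /=; first by rewrite cats0; apply: le_conn_refl.
apply: le_conn_trans (IH _ _) _ => [p pin|]; first by apply: H; rewrite inE pin orbT.
rewrite -cat1s catA; apply: le_conn_cat; last exact: le_conn_refl.
by apply: merge_le; have [] := H (i, j) (mem_head _ _).
Qed.

Lemma canon_le xs xs' st st' :
  (size st' = size xs' -> size st = size xs /\
     forall i j, (i < size xs')%N -> (j < size xs')%N ->
       nth 0%N st' i = nth 0%N st' j -> conn (state_graph xs st) (nth x0 xs' i) (nth x0 xs' j)) ->
  le_conn (state_graph xs' (canon st')) (state_graph xs st).
Proof.
move=> H e /state_graphP[sz [i [j [li lj ij ->]]]] /=; rewrite size_canon in sz.
have [szs ] := H sz; apply=> //.
by apply: canon_eq ij; rewrite sz.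
Qed.

Lemma rm_le (xs : seq V) xs' st i : size xs' = size (rm i (iota 0 (size xs))) ->
  (forall u, (u < size xs')%N -> nth x0 xs' u = nth x0 xs (bump i u)) ->
  le_conn (state_graph xs' (if size st == size xs then canon (rm i st) else [::])) (state_graph xs st).
Proof.
move=> sz' nx; case: eqP => [sz|_]; last by apply: state_graph_uniq_le.
apply: canon_le => _; split=> // u v lu lv; rewrite !nth_rm => uv.
have lt w : (w < size xs' -> bump i w < size xs)%N.
  by rewrite sz' => /bump_rm_lt; rewrite size_iota.
by rewrite !nx //; apply: state_graph_conn; rewrite ?lt.
Qed.

Lemma isolate_le xs st i : le_conn (state_graph xs (isolate i st)) (state_graph xs st).
Proof.
apply: canon_le; rewrite size_setat => sz; split=> // u v lu lv.
rewrite !nth_setat ?sz //.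
have fr w : (w < size xs)%N -> nth 0%N st w <> fresh st.
  by rewrite -sz => /fresh_gt + eq; rewrite eq ltnn.
case: eqP => [->|_]; case: eqP => [->|_].
- by move=> _; apply: conn_refl.
- by move/esym/fr.
- by move/fr.
- exact: state_graph_conn.
Qed.

Lemma extend_le xs l st : le_conn (state_graph (l ++ xs) (extend (size l) st)) (state_graph xs st).
Proof.
elim/last_ind: l xs st => [|l x IH] xs st /=; first exact: le_conn_refl.
rewrite size_rcons /= cat_rcons; apply: le_conn_trans (IH _ _) _.
move=> e /state_graphP[[sz] [i [j [li lj ij ->]]]] /=.
case: i j li lj ij => [|i] [|j] //= ; rewrite ?ltnS => li lj ij.
- exact: conn_refl.
- by have := @fresh_gt st j; rewrite sz lj -ij ltnn => /(_ isT).
- by have := @fresh_gt st i; rewrite sz li ij ltnn => /(_ isT).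
- exact: state_graph_conn.
Qed.

End Laws.

Local Open Scope ring_scope.

Opaque unit_mass.
Arguments N.shiftr : simpl never.
Arguments N.mul : simpl never.

(** * Lower bounds on partition laws, and the operations that preserve them *)

Section Soundness.
Variables (R : realFieldType) (V : eqType) (x0 : V).

Definition side : R := 2501 / 16384.
Lemma side0 : 0 <= side. Proof. by rewrite /side; lra. Qed.
Lemma side1 : side <= 1. Proof. by rewrite /side; lra. Qed.
Hint Resolve side0 side1 : core.

Notation state_graph := (state_graph x0).
(* The weights of t, divided by 2^26, bound from below the law of the partition
   of the terminals xs induced by the open edges of l.  No equality of masses
   is required, so rounding down and dropping states are harmless. *)
Definition law (t : trie) (xs : seq V) (l : seq (V * V)) :=
  forall G : seq (V * V) -> R, mono G ->
  tsum (fun st => G (state_graph xs st)) t <= wt R unit_mass * expect side l G.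

Lemma unit_massE : unit_mass = N.mul (N.pow 2 8) (N.pow 2 18).
Proof. by []. Qed.
Lemma unit_mass_gt0 : 0 < wt R unit_mass. Proof. exact: wt_gt0. Qed.

Lemma law_perm t xs l l' : perm_eq l l' -> law t xs l -> law t xs l'.
Proof.
move=> pl H G mG; rewrite -(expect_perm side (mono_submono mG) pl); exact: H.
Qed.

(** By independence the mean over [l'] is taken first, with the graph from [l] fixed; the result is
    a test function to which the law of [t] applies. *)
Lemma law_step t xs l xs' l' f : law t xs l ->
  (forall G, mono G -> forall st w acc,
     tsum (fun st => G (state_graph xs' st)) (f st w acc) <=
     tsum (fun st => G (state_graph xs' st)) acc +
     wt R w * expect side l' (fun g => G (state_graph xs st ++ g))) ->
  law (tfold f t) xs' (l ++ l').
Proof.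
move=> H step G mG; rewrite expect_cat.
apply: le_trans (tsum_tfold _ (step G mG)) _.
exact: (H (fun h => expect side l' (fun g => G (h ++ g)))) (mono_expect _ _ _ _).
Qed.

Lemma law_map t xs l xs' f : law t xs l ->
  (forall st w, le_conn (state_graph xs' (f st w)) (state_graph xs st)) ->
  law (tfold (fun st w acc => ins (f st w) w acc) t) xs' l.
Proof.
move=> H fle; rewrite -[l]cats0; apply: law_step H _ => G [G0 mG] st w acc /=.
apply: le_trans (tsum_ins _ _ _ _) _ => [st'|]; first exact: G0.
by rewrite lerD2l cats0 ler_wpM2l ?wt_ge0 // mG.
Qed.

Lemma law_start : law (Leaf unit_mass) [::] [::].
Proof. by move=> G mG; rewrite /tsum. Qed.

Lemma law_tle t t' xs l : tle t t' -> law t' xs l -> law t xs l.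
Proof.
move=> tt H G mG; apply: le_trans (H G mG); apply: tsum_tle tt => st.
by have [] := mG.
Qed.

(* The missing mass may be given to the finest partition: apply the law to
   the function obtained from G by subtracting its minimum. *)
Lemma law_refill bot t xs l : uniq bot -> law t xs l -> law (refill bot t) xs l.
Proof.
move=> ub H G mG; have [G0 Gle] := mG.
have Gbot g : G (state_graph xs bot) <= G g by apply/Gle/state_graph_uniq_le.
pose G' g := 1 * G g + (- G (state_graph xs bot)) * 1.
have mG' : mono G'.
  split=> [g|g h gh]; first by rewrite /G'; have := Gbot g; lra.
  by rewrite /G'; have := Gle _ _ gh; lra.
have := H G' mG'; rewrite expect_lin expect_cst.
have -> : tsum (fun st => G' (state_graph xs st)) t =
    tsum (fun st => G (state_graph xs st)) t - wt R (total t) * G (state_graph xs bot).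
  rewrite -tsum_total !tsumE -sumrB; apply: eq_bigr => p _.
  by rewrite /G'; ring.
move=> le; apply: le_trans (tsum_ins _ _ _ _) _ => [st|]; first exact: G0.
have [tle|tge] : (total t <= unit_mass)%num \/ (unit_mass <= total t)%num by lia.
  rewrite wt_sub //; move: (wt R unit_mass) (wt R _) le => u v; lra.
have -> : N.sub unit_mass (total t) = N0 by lia.
by rewrite wt0 mul0r addr0; apply: H.
Qed.

Lemma law_strip t xs l : law t xs l -> law (strip t) xs l.
Proof.
move=> H; rewrite -[l]cats0; apply: law_step H _ => G [G0 mG] st w acc /=.
rewrite cats0; case: ifP => _; first by rewrite lerDl mulr_ge0 ?wt_ge0.
by apply: tsum_ins.
Qed.

Lemma refines_le xs g f : refines g f -> le_conn (state_graph xs g) (state_graph xs f).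
Proof.
case/andP=> /eqP sz /allP H e /state_graphP[szg [i [j [li lj /eqP ij ->]]]] /=.
apply: state_graph_conn => //; first by rewrite -sz.
have iin k : (k < size xs)%N -> k \in iota 0 (size f) by rewrite mem_iota -sz szg.
by apply/eqP; have /allP/(_ j (iin _ lj))/implyP := H i (iin _ li); apply.
Qed.

Lemma law_move f g m t xs l : law t xs l -> law (move f g m t) xs l.
Proof.
move=> H; rewrite /move; case: ifP => // gf.
rewrite -[l]cats0; apply: law_step H _ => G [G0 mG] st w acc /=.
rewrite cats0; case: eqP => [->|_]; last exact: tsum_ins.
apply: le_trans (tsum_ins _ _ _ _) _ => [?|]; first exact: G0.
apply: le_trans (lerD (tsum_ins _ _ _ _) (lexx _)) _ => [?|]; first exact: G0.
have mw : N.le (N.min m w) w by lia.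
have := ler_wpM2l (wt_ge0 R (N.min m w)) (mG _ _ (refines_le (xs := xs) gf)).
rewrite wt_sub //; move: (wt R _) (wt R _) (tsum _ _) => u v z; lra.
Qed.

Lemma law_moves ms t xs l : law t xs l -> law (moves ms t) xs l.
Proof. by move=> H; elim: ms => //= -[[f g] m] ms IH; apply: law_move. Qed.

Lemma law_sub t (ps : seq nat) xs l xs' n : size xs = n ->
  (forall a, a \in ps -> (a < n)%N) -> xs' = [seq nth x0 xs i | i <- ps] ->
  law t xs l ->
  law (tfold (fun st w acc =>
    ins (if size st == n then canon [seq nth 0%N st i | i <- ps] else [::]) w acc) t) xs' l.
Proof.
move=> sn lt -> H; apply: law_map H _ => st _.
case: eqP => [sz|_]; last by apply: state_graph_uniq_le.
apply: canon_le; rewrite !size_map => _; split=> [|u v lu lv]; first by rewrite sn.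
by rewrite !(nth_map 0%N) // => uv; apply: state_graph_conn => //; rewrite sn ?lt ?mem_nth.
Qed.

Variable rho : nat -> V.

(** Names become vertices through [rho], so one computation with names serves every triangle. *)
Definition valid (p : dist) l := law p.2 (map rho p.1) l.

Lemma valid_start : valid start [::]. Proof. exact: law_start. Qed.

Lemma valid_reorder ts p l : valid p l -> law (reorder ts p) (map rho ts) l.
Proof.
move=> H; rewrite /reorder; case: allP => [tp|_]; last first.
  move=> G [G0 _]; rewrite /tsum /= mulr_ge0 ?wt_ge0 //; exact: expect_ge0.
apply: law_sub H; rewrite ?size_map //.
  by move=> _ /mapP[a /tp at_ ->]; rewrite index_mem.
rewrite -map_comp; apply/eq_in_map => a /tp /= at_.
by rewrite (nth_map 0%N) ?index_mem // nth_index.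
Qed.

Lemma valid_free a p l : valid p l -> valid (free a p) l.
Proof.
move=> H; rewrite /valid /free /=; set i := index a p.1.
apply: law_map H _ => st _; rewrite -(size_map rho p.1); apply: rm_le => [|u].
  by rewrite !size_map; apply: size_rm; rewrite size_iota.
rewrite size_map => lu; have lu' := bump_rm_lt lu.
by rewrite !(nth_map 0%N) // nth_rm.
Qed.

Lemma valid_frees keep ns p l : valid p l -> valid (frees keep ns p) l.
Proof.
elim: ns p => //= a ns IH p H; apply: IH; case: ifP => // _; exact: valid_free.
Qed.

Lemma valid_prune eps p l : valid p l -> valid (prune eps p) l.
Proof.
case: p => ns t; rewrite /valid /prune /=; elim: (size ns) t => //= k IH t H.
apply: IH; apply: law_map H _ => st w.
by case: ifP => _; [apply: isolate_le | apply: le_conn_refl].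
Qed.

Lemma addnames_le ts ns st :
  le_conn (state_graph (map rho (addnames ts ns)) (extend (size (addnames ts ns) - size ns) st))
    (state_graph (map rho ns) st).
Proof.
have [l ->] := addnamesE ts ns.
rewrite size_cat addnK map_cat -(size_map rho l); exact: extend_le.
Qed.

Lemma nth_rho ns a : a \in ns -> nth x0 (map rho ns) (index a ns) = rho a.
Proof. by move=> an; rewrite (nth_map 0%N) ?index_mem // nth_index. Qed.

Lemma pairs_le xs st key (ns ts : seq nat) :
  size key = size ts -> {subset ts <= ns} -> xs = map rho ns ->
  le_conn (state_graph xs (merges (pairs key [seq index a ns | a <- ts] [::]) st))
    (state_graph xs st ++ state_graph (map rho ts) key).
Proof.
move=> sz tn ->; set ps := [seq index a ns | a <- ts].
have psn v : (v < size ts)%N -> (nth 0%N ps v < size ns)%N /\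
    nth x0 (map rho ns) (nth 0%N ps v) = nth x0 (map rho ts) v.
  move=> vt; rewrite /ps (nth_map 0%N 0%N) // index_mem.
  by have tv := tn _ (mem_nth 0%N vt); rewrite tv nth_rho // (nth_map 0%N).
have prs p : p \in pairs key ps [::] -> exists u v, [/\ (u < size ts)%N, (v < size ts)%N,
    nth 0%N key u = nth 0%N key v, p.1 = nth 0%N ps u & p.2 = nth 0%N ps v].
  case: p => f q /pairsP[v [vk _ qE [//|[u [uk _ uv fE]]]]].
  by exists u, v; rewrite -sz.
apply: le_conn_trans (merges_le _) _ => [p /prs[u [v [lu lv _ -> ->]]]|].
  by rewrite size_map; split; apply psn.
apply: le_conn_cat; first exact: le_conn_refl.
move=> _ /mapP[p /prs[u [v [lu lv uv -> ->]]] ->] /=.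
have [_ ->] := psn _ lu; have [_ ->] := psn _ lv.
by apply: state_graph_conn => //; rewrite size_map.
Qed.

Lemma tsum_addmod phi M st w acc : (forall st, 0 <= phi st) ->
  tsum phi (addmod M st w acc) <= tsum phi acc +
    \sum_(m <- M) wt R (N.shiftr (N.mul m.2 w) 18) * phi (merges m.1 st).
Proof.
move=> phi0; elim: M acc => [|[ps q] M IH] acc /=; first by rewrite big_nil addr0.
rewrite big_cons addrA; apply: le_trans (IH _) _; rewrite lerD2r.
exact: tsum_ins_nz.
Qed.

Lemma valid_mod t ts p l l' : valid p l -> law t (map rho ts) l' ->
  valid (mod_step t ts p) (l ++ l').
Proof.
move=> H H'; apply: law_step H _ => G mG st w acc; have [G0 Gle] := mG.
set ns' := addnames ts p.1; set st' := extend _ st.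
apply: le_trans (tsum_addmod _ _ _ _ _) _ => [?|]; first exact: G0.
rewrite lerD2l.
(* The law of the new piece, applied with the earlier graph frozen. *)
have {H'} := H' (fun g => G (state_graph (map rho p.1) st ++ g)) (mono_catl _ mG).
set E := expect _ _ _; rewrite tsumE => H'.
have M0 := unit_mass_gt0.
rewrite -(ler_pM2l M0) mulrCA; apply: le_trans (ler_wpM2l (wt_ge0 _ _) H').
rewrite /compile big_map.
rewrite big_filter !mulr_sumr [leLHS]big_mkcond; apply: ler_sum => -[key q] _ /=.
have q0 := wt_ge0 R q; have w0 := wt_ge0 R w.
case: ifP => [/andP[/eqP sz _]|_]; last by rewrite !mulr_ge0.
have Gle' : G (state_graph (map rho ns') (merges (pairs key [seq index a ns' | a <- ts] [::]) st'))
    <= G (state_graph (map rho p.1) st ++ state_graph (map rho ts) key).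
  rewrite size_map in sz.
  have sub : {subset ts <= ns'} by move=> a ats; apply: addnames_sub; rewrite ats.
  apply: Gle; apply: le_conn_trans (pairs_le sz sub erefl) _.
  by apply: le_conn_cat; [apply: addnames_le | apply: le_conn_refl].
rewrite mulrA [leRHS]mulrA.
apply: ler_pM Gle'; [by rewrite mulr_ge0 ?wt_ge0 | exact: G0 |].
(* Both shifts round down, by 8 bits in [compile] and 18 in [addmod]; together they divide by
   [unit_mass]. *)
have := wt_shiftr R (N.mul (N.shiftr q 8) w) 18; have := wt_shiftr R q 8.
rewrite unit_massE [wt R (N.mul (N.pow _ _) _)]wtM [wt R (N.mul _ w)]wtM.
have := wt_ge0 R (N.pow 2 8).
move: (wt R (N.shiftr q 8)) (wt R (N.pow 2 8)) (wt R (N.pow 2 18)) => q' a b a0.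
move=> le1 le2; rewrite -mulrA; apply: le_trans (ler_wpM2l a0 le2) _.
by rewrite mulrA mulrC ler_wpM2l.
Qed.

(** An edge in two faces is a pair of parallel sides, each open with probability [side]. *)
Definition half_edges (e : nat * nat * bool) :=
  nseq (if e.2 then 2 else 1) (rho e.1.1, rho e.1.2).

Lemma edge_weight_le d w G g (e : V * V) : mono G ->
  wt R (N.sub w (edge_weight d w)) * G g + wt R (edge_weight d w) * G (g ++ [:: e])
  <= wt R w * expect side (nseq (if d then 2 else 1) e) (fun h => G (g ++ h)).
Proof.
move=> mG; have [G0 Gle] := mG.
have le1 : G g <= G (g ++ [:: e]) by apply/Gle/le_conn_catl.
have E2 : G (g ++ [:: e; e]) = G (g ++ [:: e]).
  by apply: submono_eq (mono_submono mG) _ => f; rewrite !mem_cat !inE orbb.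
have w0 := wt_ge0 R w.
(* [c] is the opening probability before rounding down: 2310/8192 for a double side, [side] for a
   single one. *)
have [c [cle]] : exists c : R, wt R (edge_weight d w) <= c * wt R w /\ 0 <= c <= 1 /\
    c <= if d then 1 - (1 - side) ^+ 2 else side.
  case: d; rewrite /edge_weight.
    exists (2310 / 8192); split; last by rewrite /side; split; lra.
    have := wt_shiftr R (N.mul 2310 w) 13; rewrite wtM.
    rewrite -[N.pow 2 13]/(N.of_nat 8192) -[2310%num]/(N.of_nat 2310) !wt_of_nat.
    by move: (wt R _) (wt R _) => u v; lra.
  exists side; split; last by split; rewrite ?side0 ?side1 ?lexx.
  have := wt_shiftr R (N.mul 2501 w) 14; rewrite wtM /side.
  rewrite -[N.pow 2 14]/(N.of_nat 16384) -[2501%num]/(N.of_nat 2501) !wt_of_nat.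
  by move: (wt R _) (wt R _) => u v; lra.
case=> /andP[c0 c1] cd.
have ole : N.le (edge_weight d w) w.
  have : wt R (edge_weight d w) <= wt R w by apply: le_trans cle _; rewrite ler_piMl.
  exact: le_wt.
rewrite wt_sub // ?cats0.
have cE : c * G (g ++ [:: e]) + (1 - c) * G g <=
    expect side (nseq (if d then 2 else 1) e) (fun h => G (g ++ h)).
  case: d cd {ole cle} => /= cd; rewrite ?E2 ?cats0;
    have := ler_wpM2r (_ : 0 <= G (g ++ [:: e]) - G g) cd; rewrite subr_ge0 => /(_ le1);
    move: (G g) (G (g ++ [:: e])) => A B; rewrite /side; lra.
apply: le_trans (ler_wpM2l w0 cE).
have := ler_wpM2r (_ : 0 <= G (g ++ [:: e]) - G g) cle; rewrite subr_ge0 => /(_ le1).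
move: (wt R (edge_weight d w)) (wt R w) (G g) (G (g ++ [:: e])) => o W A B; lra.
Qed.

Lemma valid_edge d a b p l : valid p l ->
  valid (edge_step d a b p) (l ++ half_edges (a, b, d)).
Proof.
move=> H; apply: law_step H _ => G mG st w acc; have [G0 Gle] := mG.
set ns' := addnames [:: a; b] p.1; set st' := extend _ st; set i := index a _; set j := index b _.
apply: le_trans (tsum_ins_nz _ _ _ _) _ => [?|]; first exact: G0.
apply: le_trans (lerD (tsum_ins _ _ _ _) (lexx _)) _ => [?|]; first exact: G0.
rewrite -addrA lerD2l addrC.
have := edge_weight_le d w (state_graph (map rho p.1) st) (rho a, rho b) mG.
apply: le_trans; apply: lerD; apply: ler_wpM2l; rewrite ?wt_ge0 //.
  by apply: Gle; apply: addnames_le.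
have an : a \in ns' by apply: addnames_sub; rewrite inE eqxx.
have bn : b \in ns' by apply: addnames_sub; rewrite !inE eqxx orbT.
apply: Gle.
have li : (i < size (map rho ns'))%N by rewrite size_map index_mem.
have lj : (j < size (map rho ns'))%N by rewrite size_map index_mem.
apply: le_conn_trans (merge_le li lj) _; rewrite !nth_rho //.
by apply: le_conn_cat; [apply: addnames_le | apply: le_conn_refl].
Qed.

Lemma valid_run_edges out es p l : valid p l ->
  valid (run_edges out es p) (l ++ flatten (map half_edges es)).
Proof.
elim: es p l => [|[[a b] d] es IH] p l H; first by rewrite cats0.
by rewrite [flatten _]/= catA; apply: IH; apply: valid_frees; apply: valid_edge.
Qed.

(** The [all2] hypothesis says that [ms] and [ls] have the same length. *)
Lemma valid_run_mods out eps ms p l ls : valid p l ->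
  all2 (fun m l' => true) ms ls ->
  (forall i, (i < size ms)%N -> let m := nth (Nil, [::]) ms i in
     law m.1 (map rho m.2) (nth [::] ls i)) ->
  valid (run_mods out eps ms p) (l ++ flatten ls).
Proof.
elim: ms ls p l => [|[t ts] ms IH] [|l' ls] p l H //= sz Hm; first by rewrite cats0.
rewrite catA; apply: IH => //; last by move=> i; apply: (Hm i.+1).
apply: valid_prune; apply: valid_frees; apply: valid_mod => //; exact: (Hm 0%N).
Qed.

End Soundness.

(** * Subdivided triangles *)

Local Open Scope nat_scope.

Lemma flatten_bind (A B C : Type) (g : A -> seq B) (h : B -> seq C) s :
  flatten (map h (flatten (map g s))) = flatten [seq flatten (map h (g x)) | x <- s].
Proof. by elim: s => //= x s IH; rewrite map_cat flatten_cat IH. Qed.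

Section Barycentric.
Variables (V : Type) (mid : V -> V -> V) (cen : V -> V -> V -> V).

(** Midpoints and centroids are abstract, so that the same subdivision runs on points of the plane
    and on symbolic vertices. *)
Definition bary (f : V * V * V) : seq (V * V * V) :=
  let: (x, y, z) := f in
  let c := cen x y z in
  let mxy := mid x y in let myz := mid y z in let mzx := mid z x in
  [:: (x, mxy, c); (mxy, y, c); (y, myz, c); (myz, z, c); (z, mzx, c); (mzx, x, c)].

Definition sides (f : V * V * V) : seq (V * V) :=
  let: (x, y, z) := f in [:: (x, y); (y, z); (z, x)].

Fixpoint subfaces n f := if n is n'.+1 then flatten (map (subfaces n') (bary f)) else [:: f].

(** Sides are listed face by face, so an edge in two faces occurs twice: this is the model with
    independent sides. *)
Fixpoint bary_edges n f : seq (V * V) :=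
  if n is n'.+1 then flatten (map (bary_edges n') (bary f)) else sides f.

Lemma bary_edgesE n f : bary_edges n f = flatten (map sides (subfaces n f)).
Proof.
elim: n f => [|n IH] f; first by rewrite /= cats0.
by rewrite [RHS]/= flatten_bind; congr flatten; apply: eq_map.
Qed.

(** [subfaces] recurses from the first subdivision, which shows self-similarity, and [faces] from
    the last one; this identity reconciles them. *)
Lemma subfacesS n f : subfaces n.+1 f = flatten (map bary (subfaces n f)).
Proof.
elim: n f => [|n IH] f; first by case: f => [[x y] z].
by rewrite [RHS]/= flatten_bind; congr flatten; apply: eq_map => g; exact: IH.
Qed.

End Barycentric.

Section Morphism.
Variables (V W : Type) (mid : V -> V -> V) (cen : V -> V -> V -> V).
Variables (mid' : W -> W -> W) (cen' : W -> W -> W -> W) (h : V -> W).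
Hypotheses (hm : forall a b, h (mid a b) = mid' (h a) (h b)).
Hypotheses (hc : forall a b c, h (cen a b c) = cen' (h a) (h b) (h c)).

Definition map_edge (e : V * V) := (h e.1, h e.2).

Lemma bary_edges_morph n x y z :
  bary_edges mid' cen' n (h x, h y, h z) = map map_edge (bary_edges mid cen n (x, y, z)).
Proof.
elim: n x y z => [|n IH] x y z //=.
by rewrite !map_cat -!IH !hc !hm.
Qed.
End Morphism.

(** * Symbolic vertices and the laws of triangles and kites *)

Local Open Scope nat_scope.

Inductive vexp := Var of nat | Mid of vexp & vexp | Cen of vexp & vexp & vexp.

Fixpoint vcmp a b :=
  match a, b with
  | Var i, Var j => Nat.compare i j
  | Var _, _ => Lt
  | Mid _ _, Var _ => Gt
  | Mid a1 a2, Mid b1 b2 => if vcmp a1 b1 is Eq then vcmp a2 b2 else vcmp a1 b1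
  | Mid _ _, Cen _ _ _ => Lt
  | Cen a1 a2 a3, Cen b1 b2 b3 =>
    if vcmp a1 b1 is Eq then if vcmp a2 b2 is Eq then vcmp a3 b3 else vcmp a2 b2
    else vcmp a1 b1
  | Cen _ _ _, _ => Gt
  end.

(** Sorting the ends makes the midpoint of a side shared by two faces the same expression in
    both. *)
Definition vmid a b := if vcmp a b is Gt then Mid b a else Mid a b.

Fixpoint vpos x l :=
  if l is y :: l' then if vcmp x y is Eq then 0 else (vpos x l').+1 else 0.

Definition vnames (es : seq (vexp * vexp)) :=
  foldl (fun acc v => if vpos v acc < size acc then acc else rcons acc v) [::]
    (flatten [seq [:: e.1; e.2] | e <- es]).

(* The kite with vertices w = 0, x = 1, m = 2, c = 3 has faces wxc and xmc; in a
   subdivided triangle x is a corner, w and m are the midpoints of its sides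
   and c is the centroid. *)
Definition kite_terms :=
  bary_edges vmid Cen 2 (Var 0, Var 1, Var 3) ++ bary_edges vmid Cen 2 (Var 1, Var 2, Var 3).
Definition kite_names := vnames kite_terms.

Definition edge_index (e : vexp * vexp) := (vpos e.1 kite_names, vpos e.2 kite_names).
Definition sort_edge (e : nat * nat) := if e.1 <= e.2 then e else (e.2, e.1).

Lemma vcmp_eq a b : vcmp a b = Eq -> a = b.
Proof.
elim: a b => [i|a1 IH1 a2 IH2|a1 IH1 a2 IH2 a3 IH3] [j|b1 b2|b1 b2 b3] //=.
- by rewrite compareP; case: ltngtP => // ->.
- by case E1: vcmp => // /IH2 ->; rewrite (IH1 _ E1).
- by case E1: vcmp => //; case E2: vcmp => // /IH3 ->; rewrite (IH1 _ E1) (IH2 _ E2).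
Qed.

Lemma nth_vpos x l : vpos x l < size l -> nth (Var 0) l (vpos x l) = x.
Proof.
elim: l => //= y l IH; case E: vcmp => //=; rewrite ?ltnS => // _.
by rewrite (vcmp_eq E).
Qed.

Lemma midptC u v : midpt u v = midpt v u.
Proof. by rewrite /midpt /ptadd addrC [X in (_, X, _)]addrC [X in (_, _, X)]addrC. Qed.

Fixpoint veval (val : nat -> pt) e :=
  match e with
  | Var i => val i
  | Mid a b => midpt (veval val a) (veval val b)
  | Cen a b c => centroid (veval val a) (veval val b) (veval val c)
  end.

Lemma veval_mid val a b : veval val (vmid a b) = midpt (veval val a) (veval val b).
Proof. by rewrite /vmid; case: vcmp => //=; rewrite midptC. Qed.

Notation face_edges := (bary_edges midpt centroid).

Section Chain.
Variable R : realFieldType.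
Notation law := (@law R _ (v0 : pt)).
Notation side := (side R).

Definition law6 t n := forall x y z : pt,
  law t [:: x; y; z; midpt x y; midpt y z; midpt z x] (face_edges n (x, y, z)).
(** Kites are glued along [wc] and [mc], hence the choice of these two midpoints as terminals. *)
Definition kite_law t n := forall w x m c : pt,
  law t [:: w; x; m; c; midpt w c; midpt m c]
    (face_edges n (w, x, c) ++ face_edges n (x, m, c)).

Lemma law_sort (rho : nat -> pt) t xs (l l' : seq (nat * nat)) :
  perm_eq (map sort_edge l) (map sort_edge l') ->
  law t xs (map (map_edge rho) l) -> law t xs (map (map_edge rho) l').
Proof.
have srt L G : mono G -> expect side (map (map_edge rho) (map sort_edge L)) G =
    expect side (map (map_edge rho) L) G.
  move=> mG; rewrite -map_comp !expect_map; apply: expect_ext => g.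
  apply: mono_eq => // _ /mapP[[a b] eg ->] /=; rewrite /sort_edge /=.
    have : conn (map (map_edge rho) g) (rho a) (rho b).
      by apply/conn1/(map_f (map_edge rho) eg).
    by case: ifP => // _; apply: conn_sym.
  have := map_f (map_edge rho \o sort_edge) eg; rewrite /sort_edge /=.
  by case: ifP => _ /conn1 //; apply: conn_sym.
move=> pl H G mG; apply: le_trans (H G mG) _.
by rewrite -srt // -[in leRHS]srt // (expect_perm _ (mono_submono mG) (perm_map _ pl)).
Qed.

End Chain.

(** * The computation *)

Local Open Scope nat_scope.

(* The 116 edges of the twice subdivided kite, marked true when they lie in two
   faces, in an order keeping few vertices live; vertices are numbered by
   their positions in [kite_names]. *)
Definition kite_edges : seq (nat * nat * bool) := [::
(3,7,false); (8,7,true); (7,9,false); (8,3,true); (8,9,true); (8,10,true);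
(5,8,true); (8,4,true); (3,4,true); (5,4,true); (2,4,true); (2,3,true);
(3,1,false); (2,1,true); (1,0,false); (2,0,true); (5,2,true); (2,6,true);
(5,6,true); (6,0,true); (24,6,true); (10,9,true); (5,10,true); (12,10,true);
(24,23,true); (23,0,false); (21,23,false); (24,21,true); (24,0,true);
(5,24,true); (24,22,true); (21,22,true); (5,22,true); (20,22,true);
(20,19,true); (21,19,false); (19,17,false); (20,17,true); (20,21,true);
(5,20,true); (20,18,true); (18,17,true); (5,18,true); (16,18,true);
(5,12,true); (5,16,true); (5,14,true); (12,14,true); (16,14,true);
(13,14,true); (12,9,true); (12,13,true); (12,11,true); (16,13,true);
(16,17,true); (16,15,true); (13,15,true); (15,17,true); (42,15,true);
(11,9,true); (13,11,true); (44,11,true); (42,13,true); (44,13,true);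
(13,43,true); (42,43,true); (44,43,true); (29,43,true); (42,17,true);
(29,42,true); (42,41,true); (44,9,true); (29,44,true); (44,30,true);
(29,30,true); (30,9,true); (26,30,true); (41,17,true); (29,41,true);
(40,41,true); (25,9,false); (26,25,true); (27,25,false); (26,9,true);
(26,27,true); (29,26,true); (26,28,true); (27,28,true); (29,28,true);
(32,28,true); (32,27,true); (27,31,false); (32,31,true); (31,33,false);
(32,33,true); (29,32,true); (32,34,true); (34,33,true); (29,34,true);
(36,34,true); (29,36,true); (29,40,true); (29,38,true); (36,38,true);
(40,38,true); (37,38,true); (36,33,true); (36,37,true); (36,35,true);
(35,33,false); (37,35,false); (40,37,true); (40,17,true); (40,39,true);
(37,39,false); (39,17,false)].

(** The names of [w], [x], [m], [c] and the midpoints of [wc] and [mc], as checked in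
    [kite_outE]. *)
Definition kite_out := [:: 0; 9; 33; 17; 21; 37].

(** The partition into singletons; canonical labels count blocks from the last terminal. *)
Definition bottom6 := [:: 5; 4; 3; 2; 1; 0].
Definition points6 := [:: 0; 1; 2; 3; 4; 5].

Definition base_kite := refill bottom6 (reorder kite_out (run_edges kite_out kite_edges start)).

(* Vertices 0 to 6 are w, x, m, c and the midpoints of wc, mc and cx. *)
Definition kite eps t :=
  let t5 := reorder [:: 0; 1; 2; 4; 5] (points6, t) in
  refill bottom6 (reorder points6 (run_mods points6 eps
    [:: (t5, [:: 0; 1; 3; 6; 4]); (t5, [:: 1; 2; 3; 5; 6])] start)).

(* Vertices 0 to 9 are the corners x, y, z, the midpoints of xy, yz and zx, the
   centroid c, and the midpoints between c and the midpoints of zx, xy and yz. *)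
Definition three_kites eps k :=
  reorder points6 (run_mods points6 eps
    [:: (k, [:: 5; 0; 3; 6; 7; 8]); (k, [:: 3; 1; 4; 6; 8; 9]);
        (k, [:: 4; 2; 5; 6; 9; 7])] start).

(* A transport plan: the weights of most partitions increase under one more
   subdivision, and part of this excess is moved to the finer partitions whose
   weights decrease. *)
Definition mass_moves : seq (seq nat * seq nat * N) := [::
  ([:: 0; 0; 0; 0; 0; 0], [:: 0; 0; 0; 2; 1; 0], 38278%num);
  ([:: 0; 0; 0; 0; 0; 0], [:: 1; 1; 1; 2; 1; 0], 38303%num);
  ([:: 0; 0; 0; 0; 0; 0], [:: 2; 2; 2; 2; 1; 0], 38438%num);
  ([:: 0; 0; 0; 0; 0; 0], [:: 3; 2; 3; 2; 1; 0], 9295%num);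
  ([:: 0; 0; 0; 0; 1; 0], [:: 2; 3; 3; 2; 1; 0], 9372%num);
  ([:: 0; 0; 0; 0; 1; 0], [:: 3; 3; 3; 2; 1; 0], 13034%num);
  ([:: 0; 0; 0; 1; 0; 0], [:: 3; 3; 3; 2; 1; 0], 23084%num);
  ([:: 0; 0; 1; 0; 0; 0], [:: 2; 2; 3; 2; 1; 0], 25405%num);
  ([:: 0; 0; 1; 0; 0; 0], [:: 4; 4; 3; 2; 1; 0], 58514%num);
  ([:: 0; 0; 1; 0; 1; 0], [:: 4; 4; 3; 2; 1; 0], 14253%num);
  ([:: 0; 0; 2; 0; 1; 0], [:: 0; 0; 3; 2; 1; 0], 37626%num);
  ([:: 0; 0; 2; 1; 0; 0], [:: 4; 4; 3; 2; 1; 0], 12812%num);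
  ([:: 0; 1; 0; 0; 0; 0], [:: 0; 3; 0; 2; 1; 0], 27332%num);
  ([:: 0; 1; 0; 0; 0; 0], [:: 3; 4; 3; 2; 1; 0], 57898%num);
  ([:: 0; 1; 0; 0; 1; 0], [:: 3; 4; 3; 2; 1; 0], 15034%num);
  ([:: 0; 1; 0; 1; 0; 0], [:: 1; 2; 1; 2; 1; 0], 792%num);
  ([:: 0; 1; 0; 1; 0; 0], [:: 3; 4; 3; 2; 1; 0], 15962%num);
  ([:: 0; 1; 0; 1; 1; 0], [:: 2; 1; 2; 1; 1; 0], 1545%num);
  ([:: 0; 1; 0; 2; 1; 0], [:: 3; 1; 3; 2; 1; 0], 9188%num);
  ([:: 0; 1; 1; 0; 1; 0], [:: 0; 2; 2; 0; 1; 0], 838%num);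
  ([:: 0; 1; 1; 1; 1; 0], [:: 3; 1; 1; 2; 1; 0], 15137%num);
  ([:: 0; 1; 1; 2; 1; 0], [:: 0; 3; 3; 2; 1; 0], 9194%num);
  ([:: 0; 1; 3; 2; 1; 0], [:: 4; 1; 3; 2; 1; 0], 27435%num);
  ([:: 0; 2; 0; 0; 1; 0], [:: 2; 3; 2; 2; 1; 0], 38130%num);
  ([:: 0; 2; 0; 1; 0; 0], [:: 1; 3; 1; 2; 1; 0], 37953%num);
  ([:: 0; 2; 0; 1; 1; 0], [:: 3; 4; 3; 2; 1; 0], 614%num);
  ([:: 0; 2; 0; 2; 1; 0], [:: 3; 4; 3; 2; 1; 0], 11078%num);
  ([:: 0; 2; 1; 0; 0; 0], [:: 1; 4; 3; 2; 1; 0], 29400%num);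
  ([:: 0; 2; 3; 2; 1; 0], [:: 0; 4; 3; 2; 1; 0], 29107%num);
  ([:: 0; 3; 2; 0; 1; 0], [:: 2; 4; 3; 2; 1; 0], 31602%num);
  ([:: 1; 0; 0; 0; 0; 0], [:: 4; 3; 3; 2; 1; 0], 86259%num);
  ([:: 1; 0; 0; 1; 0; 0], [:: 4; 3; 3; 2; 1; 0], 16498%num);
  ([:: 1; 1; 0; 1; 0; 0], [:: 2; 2; 0; 1; 0; 0], 1110%num);
  ([:: 1; 1; 0; 1; 1; 0], [:: 4; 4; 3; 2; 1; 0], 15574%num);
  ([:: 1; 1; 1; 1; 1; 0], [:: 3; 3; 3; 2; 1; 0], 22980%num);
  ([:: 1; 1; 2; 1; 1; 0], [:: 1; 1; 3; 2; 1; 0], 37613%num);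
  ([:: 1; 1; 2; 1; 1; 0], [:: 4; 4; 3; 2; 1; 0], 8456%num);
  ([:: 1; 2; 0; 2; 1; 0], [:: 1; 2; 3; 2; 1; 0], 24%num);
  ([:: 1; 2; 1; 1; 1; 0], [:: 3; 4; 3; 2; 1; 0], 12273%num);
  ([:: 2; 0; 0; 0; 1; 0], [:: 4; 3; 3; 2; 1; 0], 11121%num);
  ([:: 2; 0; 0; 1; 0; 0], [:: 3; 0; 0; 2; 1; 0], 38215%num);
  ([:: 2; 0; 0; 1; 0; 0], [:: 3; 1; 1; 2; 1; 0], 4087%num);
  ([:: 2; 0; 1; 0; 0; 0], [:: 4; 0; 3; 2; 1; 0], 29615%num);
  ([:: 2; 1; 0; 0; 0; 0], [:: 4; 3; 2; 2; 1; 0], 29943%num);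
  ([:: 2; 1; 1; 1; 1; 0], [:: 3; 2; 2; 2; 1; 0], 38130%num);
  ([:: 2; 1; 1; 2; 1; 0], [:: 3; 1; 1; 2; 1; 0], 8333%num);
  ([:: 2; 2; 0; 2; 1; 0], [:: 3; 3; 0; 2; 1; 0], 9001%num);
  ([:: 2; 2; 1; 2; 1; 0], [:: 3; 3; 1; 2; 1; 0], 9125%num);
  ([:: 2; 2; 1; 2; 1; 0], [:: 4; 4; 3; 2; 1; 0], 2983%num);
  ([:: 2; 3; 0; 2; 1; 0], [:: 4; 3; 0; 2; 1; 0], 28974%num);
  ([:: 3; 1; 2; 1; 1; 0], [:: 4; 2; 3; 2; 1; 0], 32891%num);
  ([:: 3; 2; 0; 1; 0; 0], [:: 4; 3; 1; 2; 1; 0], 29821%num)].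

(** The partition into singletons is left out of the comparison with the next level, since
    [law_refill] restores its weight afterwards. *)
Definition face_part := strip (three_kites 5000 base_kite).
Definition face_law := refill bottom6 face_part.
Definition next_face_law := moves mass_moves (three_kites 5000 (kite 5000 face_law)).

Lemma kite_terms_indexed :
  all (fun e => (vpos e.1 kite_names < size kite_names) &&
                (vpos e.2 kite_names < size kite_names)) kite_terms.
Proof. by vm_cast_no_check (erefl true). Qed.

Lemma kite_edges_perm :
  perm_eq (map sort_edge (flatten (map (half_edges id) kite_edges)))
          (map sort_edge (map edge_index kite_terms)).
Proof. by vm_cast_no_check (erefl true). Qed.

Lemma kite_outE :
  [seq nth (Var 0) kite_names i | i <- kite_out] =
  [:: Var 0; Var 1; Var 2; Var 3; vmid (Var 0) (Var 3); vmid (Var 2) (Var 3)].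
Proof. by vm_compute. Qed.

(** The numerical heart: the first comparison is the induction step of [face_lawP], the second gives
    positive weight to the partition with one block. *)
Lemma face_law_stable :
  tle face_part next_face_law && tle (ins [:: 0; 0; 0; 0; 0; 0] 1 Nil) face_law.
Proof. by vm_cast_no_check (erefl true). Qed.

Local Open Scope nat_scope.

Opaque kite_terms kite_names kite_edges run_edges run_mods reorder refill.

Lemma eq_map_all (T U : Type) (P : pred T) (f g : T -> U) s :
  all P s -> (forall x, P x -> f x = g x) -> map f s = map g s.
Proof. by move=> + fg; elim: s => //= x s IH /andP[/fg -> /IH ->]. Qed.

(** * Induction on the number of subdivisions *)

Section Chain.
Variable R : realFieldType.
Notation law := (@law R _ (v0 : pt)).
Notation law6 := (@law6 R).
Notation kite_law := (@kite_law R).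
Notation side := (side R).

Lemma base_kite_law : kite_law base_kite 2.
Proof.
move=> w x m c; rewrite /base_kite; refine (law_refill _ _); first by [].
pose rho i := veval (nth (v0 : pt) [:: w; x; m; c]) (nth (Var 0) kite_names i).
have -> : [:: w; x; m; c; midpt w c; midpt m c] = map rho kite_out.
  have -> : map rho kite_out =
    map (veval (nth (v0 : pt) [:: w; x; m; c])) [seq nth (Var 0) kite_names i | i <- kite_out].
    by rewrite -map_comp.
  by rewrite kite_outE !map_cons !veval_mid.
have -> : face_edges 2 (w, x, c) ++ face_edges 2 (x, m, c) =
    map (map_edge rho) (map edge_index kite_terms).
  have e3 i j k := bary_edges_morph (cen := Cen) (cen' := centroid)
    (h := veval (nth (v0 : pt) [:: w; x; m; c]))
    (veval_mid _) (fun _ _ _ => erefl) 2 (Var i) (Var j) (Var k).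
  rewrite (e3 0 1 3) (e3 1 2 3) -map_cat -/kite_terms -map_comp.
  by apply: eq_map_all kite_terms_indexed _ => -[a b] /andP[la lb]; congr (_, _);
    rewrite /rho /= nth_vpos.
apply: law_sort kite_edges_perm _.
have -> : map (map_edge rho) (flatten (map (half_edges id) kite_edges)) =
    flatten (map (half_edges rho) kite_edges).
  rewrite map_flatten -map_comp; congr flatten; apply: eq_map => -[[a b] []] //.
have V := @valid_run_edges R _ (v0 : pt) rho kite_out kite_edges _ _ (@valid_start R _ (v0 : pt) rho).
exact: valid_reorder V.
Qed.

Lemma kite_lawP eps t n : law6 t n -> kite_law (kite eps t) n.
Proof.
move=> Ht w x m c; rewrite /kite; refine (law_refill _ _); first by [].
pose rho := nth (v0 : pt) [:: w; x; m; c; midpt w c; midpt m c; midpt c x].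
(* In both faces of the kite, [ab] lies on a side of the large triangle, so its midpoint is
   dropped. *)
have t5 a b d : law (reorder [:: 0; 1; 2; 4; 5] (points6, t))
    [:: a; b; d; midpt b d; midpt d a] (face_edges n (a, b, d)).
  exact: (valid_reorder [:: 0; 1; 2; 4; 5]
    (rho := nth (v0 : pt) [:: a; b; d; midpt a b; midpt b d; midpt d a]) (p := (points6, t)) (Ht a b d)).
rewrite -[[:: w; x; _; _; _; _]]/(map rho points6) -(cats0 (face_edges n (x, m, c))).
rewrite -[_ ++ _]/([::] ++ flatten [:: face_edges n (w, x, c); face_edges n (x, m, c)]).
apply: valid_reorder; apply: valid_run_mods => //.
case=> [|[|//]] _ /=.
  by have := t5 w x c; rewrite (midptC x c) (midptC c w).
by have := t5 x m c.
Qed.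

(** The last of the six faces in [bary] is moved to the front, next to the other face at [x]. *)
Lemma face_edges_kites n x y z :
  perm_eq (flatten
    [:: face_edges n (midpt z x, x, centroid x y z) ++ face_edges n (x, midpt x y, centroid x y z);
        face_edges n (midpt x y, y, centroid x y z) ++ face_edges n (y, midpt y z, centroid x y z);
        face_edges n (midpt y z, z, centroid x y z) ++ face_edges n (z, midpt z x, centroid x y z)])
    (face_edges n.+1 (x, y, z)).
Proof. by rewrite /= !cats0 -!catA perm_catC -!catA. Qed.

Lemma three_kites_law eps k n : kite_law k n -> law6 (three_kites eps k) n.+1.
Proof.
move=> Hk x y z; rewrite /three_kites; apply: law_perm (face_edges_kites n x y z) _.
pose rho := nth (v0 : pt) [:: x; y; z; midpt x y; midpt y z; midpt z x;
     centroid x y z; midpt (midpt z x) (centroid x y z); midpt (midpt x y) (centroid x y z);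
     midpt (midpt y z) (centroid x y z)].
rewrite -[[:: x; _; _; _; _; _]]/(map rho points6) -[flatten _]/([::] ++ flatten _).
apply: valid_reorder; apply: valid_run_mods => //.
by case=> [|[|[|//]]] _; apply: Hk.
Qed.

Lemma law6_refill t n : law6 t n -> law6 (refill bottom6 t) n.
Proof. by move=> H x y z; refine (law_refill _ _). Qed.

(** Twice subdivided kites form a triangle subdivided three times, which starts the induction. In
    the step, the law at level [n] gives kites at level [n], then triangles at level [n.+1], whose
    law dominates [face_part] after the moves. *)
Lemma face_lawP n : 3 <= n -> law6 face_law n.
Proof.
elim: n => // n IH; rewrite leq_eqVlt => /predU1P[<-|/IH H]; apply: law6_refill.
  by move=> x y z; apply: law_strip; apply: three_kites_law base_kite_law _ _ _.
move=> x y z; have /andP[le _] := face_law_stable; apply: law_tle le _.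
by apply: law_moves; apply: three_kites_law (kite_lawP _ H) _ _ _.
Qed.

Local Open Scope ring_scope.

Lemma expect_conn_ge n (G : seq (pt * pt) -> R) x y z : (3 <= n)%N -> mono G ->
  (forall g, conn g x y -> 1 <= G g) ->
  wt R 1 <= wt R unit_mass * expect side (face_edges n (x, y, z)) G.
Proof.
move=> n3 mG G1; apply: le_trans (face_lawP n3 x y z mG).
set xs := [:: x; _; _; _; _; _].
have G0 st : 0 <= G (state_graph (v0 : pt) xs st) by have [] := mG.
have /andP[_ le] := face_law_stable.
apply: le_trans (tsum_tle G0 le); rewrite /tsum {le} /= !addr0.
rewrite ler_peMr ?wt_ge0 //; apply: G1.
exact: (@state_graph_conn _ (v0 : pt) xs [:: 0; 0; 0; 0; 0; 0]%N 0 1).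
Qed.

End Chain.

(** * Every edge lies in at most two triangles *)

Local Open Scope ring_scope.

(** The affine map taking [v0], [v1], [v2] to the corners of [f]. *)
Definition lin (f : face) (p : pt) : pt :=
  ptadd (ptadd (ptscale p.1.1 f.1.1) (ptscale p.1.2 f.1.2)) (ptscale p.2 f.2).

Lemma lin_midpt f a b : lin f (midpt a b) = midpt (lin f a) (lin f b).
Proof.
by case: f a b => [[x y] z] a b; congr (_, _, _); rewrite /=; ring.
Qed.

Lemma lin_centroid f a b c : lin f (centroid a b c) = centroid (lin f a) (lin f b) (lin f c).
Proof.
by case: f a b c => [[x y] z] a b c; congr (_, _, _); rewrite /=; ring.
Qed.

Definition unit_face : face := (v0, v1, v2).

Lemma face_edges_lin n f :
  face_edges n f = map (map_edge (lin f)) (face_edges n unit_face).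
Proof.
rewrite -(bary_edges_morph (lin_midpt f) (lin_centroid f)).
case: f => [[[[x1 x2] x3] [[y1 y2] y3]] [[z1 z2] z3]].
by congr bary_edges; congr (_, _, _); congr (_, _, _) => /=; ring.
Qed.

(* The inverses of the affine maps sending the triangle to its six parts. *)
Definition unlin0 (p : pt) : pt := (p.1.1 - p.1.2, 2 * (p.1.2 - p.2), 3 * p.2).
Definition unlin1 (p : pt) : pt := (2 * (p.1.1 - p.2), p.1.2 - p.1.1, 3 * p.2).
Definition unlin2 (p : pt) : pt := (p.1.2 - p.2, 2 * (p.2 - p.1.1), 3 * p.1.1).
Definition unlin3 (p : pt) : pt := (2 * (p.1.2 - p.1.1), p.2 - p.1.2, 3 * p.1.1).
Definition unlin4 (p : pt) : pt := (p.2 - p.1.1, 2 * (p.1.1 - p.1.2), 3 * p.1.2).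
Definition unlin5 (p : pt) : pt := (2 * (p.2 - p.1.2), p.1.1 - p.2, 3 * p.1.2).

Definition same_edge (e q : pt * pt) := (q == e) || (q == (e.2, e.1)).

Definition mult n (a b : pt) := count (same_edge (a, b)) (face_edges n unit_face).

Lemma mult_lin n f g a b : cancel (lin f) g -> cancel g (lin f) ->
  count (same_edge (a, b)) (face_edges n f) = mult n (g a) (g b).
Proof.
move=> fg gf; rewrite face_edges_lin count_map; apply: eq_count => -[p q] /=.
by rewrite /same_edge /map_edge /= !xpair_eqE !(can2_eq fg gf).
Qed.

Lemma multS n a b : mult n.+1 a b =
  (mult n (unlin0 a) (unlin0 b) + mult n (unlin1 a) (unlin1 b) +
   mult n (unlin2 a) (unlin2 b) + mult n (unlin3 a) (unlin3 b) +
   mult n (unlin4 a) (unlin4 b) + mult n (unlin5 a) (unlin5 b))%N.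
Proof.
rewrite {1}/mult /= !count_cat /= addn0 !addnA.
congr (_ + _ + _ + _ + _ + _)%N; apply: mult_lin => -[[x y] z];
  congr (_, _, _); rewrite /=; by field.
Qed.

Definition in_tri (p : pt) :=
  [&& 0 <= p.1.1, 0 <= p.1.2, 0 <= p.2 & p.1.1 + p.1.2 + p.2 == 1].

Definition on_side (a b : pt) :=
  [|| (a.1.1 == 0) && (b.1.1 == 0), (a.1.2 == 0) && (b.1.2 == 0) |
      (a.2 == 0) && (b.2 == 0)].

(** A bound strong enough for induction on subdivisions: 0 unless both ends lie in the triangle, 1
    on its boundary, 2 elsewhere. *)
Definition max_mult a b : nat :=
  if in_tri a && in_tri b then if on_side a b then 1 else 2 else 0.

Lemma mult0_le a b : (mult 0 a b <= max_mult a b)%N.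
Proof.
have H q : same_edge (a, b) q -> (a, b) = q \/ (a, b) = (q.2, q.1).
  by case: q => q1 q2 /orP[/eqP ->|/eqP[-> ->]]; [left | right].
rewrite /mult /=.
case: (boolP (same_edge (a, b) (v0, v1))) => [/H[][-> ->] //|_].
case: (boolP (same_edge (a, b) (v1, v2))) => [/H[][-> ->] //|_].
by case: (boolP (same_edge (a, b) (v2, v0))) => [/H[][-> ->] //|_].
Qed.

Lemma in_triP (p : pt) : in_tri p ->
  [/\ 0 <= p.1.1, 0 <= p.1.2, 0 <= p.2 & p.1.1 + p.1.2 + p.2 = 1].
Proof. by case/and4P=> ? ? ? /eqP. Qed.

Definition coord (k : nat) (p : pt) : rat :=
  match k with 0 => p.1.1 | 1 => p.1.2 | _ => p.2 end.

Lemma on_sideP a b :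
  reflect (exists k, coord k a = 0 /\ coord k b = 0) (on_side a b).
Proof.
apply: (iffP or3P) => [[] /andP[/eqP a0 /eqP b0]|[[|[|k]] /= [a0 b0]]].
- by exists 0%N.
- by exists 1%N.
- by exists 2%N.
- by constructor 1; rewrite a0 b0 eqxx.
- by constructor 2; rewrite a0 b0 eqxx.
- by constructor 3; rewrite a0 b0 eqxx.
Qed.

(** Parts that are not neighbours around the centroid share a single point, hence no edge. *)
Definition opposite (g h : pt -> pt) :=
  exists q : pt, forall p, in_tri (g p) -> in_tri (h p) -> p = q.
(* Adjacent parts share a segment, which meets the boundary at one end q only. *)
Definition adjacent (g h : pt -> pt) :=
  exists k l, exists q : pt, forall p, in_tri (g p) -> in_tri (h p) ->
    [/\ coord k (g p) = 0, coord l (h p) = 0 & forall m, coord m p = 0 -> p = q].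

Ltac in_tri_lra := move=> [[x y] z] /in_triP[/= ? ? ? ?] /in_triP[/= ? ? ? ?].
Ltac opposite_lra := exists (1/3, 1/3, 1/3); in_tri_lra; congr (_, _, _); lra.
Ltac adjacent_lra k l q :=
  exists k, l, q; in_tri_lra; split; [by rewrite /=; lra | by rewrite /=; lra |];
  by case=> [|[|m]] /= ?; congr (_, _, _); lra.

Lemma adjacent01 : adjacent unlin0 unlin1.
Proof. adjacent_lra 0%N 1%N ((1/2, 1/2, 0) : pt). Qed.
Lemma adjacent12 : adjacent unlin1 unlin2.
Proof. adjacent_lra 0%N 1%N (v1 : pt). Qed.
Lemma adjacent23 : adjacent unlin2 unlin3.
Proof. adjacent_lra 0%N 1%N ((0, 1/2, 1/2) : pt). Qed.
Lemma adjacent34 : adjacent unlin3 unlin4.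
Proof. adjacent_lra 0%N 1%N (v2 : pt). Qed.
Lemma adjacent45 : adjacent unlin4 unlin5.
Proof. adjacent_lra 0%N 1%N ((1/2, 0, 1/2) : pt). Qed.
Lemma adjacent50 : adjacent unlin5 unlin0.
Proof. adjacent_lra 0%N 1%N (v0 : pt). Qed.
Lemma opposite02 : opposite unlin0 unlin2. Proof. opposite_lra. Qed.
Lemma opposite03 : opposite unlin0 unlin3. Proof. opposite_lra. Qed.
Lemma opposite04 : opposite unlin0 unlin4. Proof. opposite_lra. Qed.
Lemma opposite13 : opposite unlin1 unlin3. Proof. opposite_lra. Qed.
Lemma opposite14 : opposite unlin1 unlin4. Proof. opposite_lra. Qed.
Lemma opposite15 : opposite unlin1 unlin5. Proof. opposite_lra. Qed.
Lemma opposite24 : opposite unlin2 unlin4. Proof. opposite_lra. Qed.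
Lemma opposite25 : opposite unlin2 unlin5. Proof. opposite_lra. Qed.
Lemma opposite35 : opposite unlin3 unlin5. Proof. opposite_lra. Qed.

Local Open Scope ring_scope.

(** In each part the last coordinate is the weight of the centroid; it vanishes on the outer side of
    the part. *)
Definition contained (g : pt -> pt) := forall p, in_tri (g p) ->
  in_tri p /\ forall k, coord k p = 0 -> coord 2 (g p) = 0.

Ltac contained_lra :=
  move=> [[x y] z] /in_triP[/= ? ? ? ?]; split;
  [by apply/and4P; split; rewrite /=; [lra | lra | lra | apply/eqP; lra] | by case=> [|[|m]] /= ?; lra].

Lemma contained0 : contained unlin0. Proof. contained_lra. Qed.
Lemma contained1 : contained unlin1. Proof. contained_lra. Qed.
Lemma contained2 : contained unlin2. Proof. contained_lra. Qed.
Lemma contained3 : contained unlin3. Proof. contained_lra. Qed.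
Lemma contained4 : contained unlin4. Proof. contained_lra. Qed.
Lemma contained5 : contained unlin5. Proof. contained_lra. Qed.

Section Parts.
Variables a b : pt.
Hypothesis ab : a != b.

Definition meets (g : pt -> pt) := in_tri (g a) && in_tri (g b).

Lemma meets_contained g : contained g ->
  (meets g ==> in_tri a && in_tri b) && (meets g && on_side a b ==> on_side (g a) (g b)).
Proof.
move=> cg; rewrite /meets; case ga: (in_tri (g a)); case gb: (in_tri (g b)) => //=.
have [-> ka] := cg _ ga; have [-> kb] := cg _ gb => /=.
by apply/implyP => /on_sideP[k [/ka a0 /kb b0]]; apply/on_sideP; exists 2%N.
Qed.

Lemma meets_opposite g h : opposite g h -> ~~ (meets g && meets h).
Proof.
case=> q gh; apply/negP => /andP[/andP[ga gb] /andP[ha hb]].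
by case/negP: ab; rewrite (gh a) // (gh b).
Qed.

Lemma meets_adjacent g h : adjacent g h ->
  meets g && meets h ==> [&& on_side (g a) (g b), on_side (h a) (h b) & ~~ on_side a b].
Proof.
case=> k [l [q gh]]; apply/implyP => /andP[/andP[ga gb] /andP[ha hb]].
have [ka la qa] := gh _ ga ha; have [kb lb qb] := gh _ gb hb.
apply/and3P; split; [by apply/on_sideP; exists k | by apply/on_sideP; exists l |].
by apply/on_sideP => -[m [/qa aq /qb bq]]; case/negP: ab; rewrite aq bq.
Qed.

(** At most two of the six cyclically arranged parts contain both ends. If two do, they are
    adjacent, and the edge is on a side of each but not on the boundary: 1 + 1 = 2. If one does,
    [meets_contained] applies. The rest is a Boolean check. *)
Lemma max_mult_parts :
  (max_mult (unlin0 a) (unlin0 b) + max_mult (unlin1 a) (unlin1 b) +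
   max_mult (unlin2 a) (unlin2 b) + max_mult (unlin3 a) (unlin3 b) +
   max_mult (unlin4 a) (unlin4 b) + max_mult (unlin5 a) (unlin5 b) <= max_mult a b)%N.
Proof.
have E g : max_mult (g a) (g b) = if meets g then if on_side (g a) (g b) then 1%N else 2 else 0 by [].
rewrite (E unlin0) (E unlin1) (E unlin2) (E unlin3) (E unlin4) (E unlin5) /max_mult.
have := meets_contained contained0; have := meets_contained contained1.
have := meets_contained contained2; have := meets_contained contained3.
have := meets_contained contained4; have := meets_contained contained5.
have := meets_adjacent adjacent01; have := meets_adjacent adjacent12.
have := meets_adjacent adjacent23; have := meets_adjacent adjacent34.
have := meets_adjacent adjacent45; have := meets_adjacent adjacent50.
have := meets_opposite opposite02; have := meets_opposite opposite03.
have := meets_opposite opposite04; have := meets_opposite opposite13.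
have := meets_opposite opposite14; have := meets_opposite opposite15.
have := meets_opposite opposite24; have := meets_opposite opposite25.
have := meets_opposite opposite35.
move: (on_side a b) (in_tri a && in_tri b) (meets unlin0) (meets unlin1) (meets unlin2)
  (meets unlin3) (meets unlin4) (meets unlin5) (on_side (unlin0 a) _) (on_side (unlin1 a) _)
  (on_side (unlin2 a) _) (on_side (unlin3 a) _) (on_side (unlin4 a) _) (on_side (unlin5 a) _).
by case; case; do 6 (case=> //=); do 6 (case=> //=).
Qed.

End Parts.

Lemma mult_le n a b : a != b -> (mult n a b <= max_mult a b)%N.
Proof.
elim: n a b => [|n IH] a b ab; first exact: mult0_le.
rewrite multS; apply: leq_trans (max_mult_parts ab).
have neq g : (forall p q : pt, g p = g q -> p = q) -> g a != g b.
  by move=> gi; apply: contra ab => /eqP /gi ->.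
do ?[apply: leq_add]; apply: IH; apply: neq => -[[x y] z] [[x' y'] z'] [e1 e2 e3];
  congr (_, _, _); lra.
Qed.

(** * Crossing probabilities *)

Local Open Scope ring_scope.

Opaque wt unit_mass.

(** * From sums over sets of open edges to recursive means *)

Section SubsetSum.
Variables (R : realFieldType) (A : eqType) (x0 : A) (p : R).

Definition picked (u : seq A) (O : {set 'I_(size u)}) := [seq nth x0 u (val i) | i <- enum O].

Lemma big_set_ordS m (F : {set 'I_m.+1} -> R) :
  \sum_O F O = \sum_(O : {set 'I_m}) F (ord0 |: [set lift ord0 i | i in O])
             + \sum_(O : {set 'I_m}) F [set lift ord0 i | i in O].
Proof.
have l0 (i : 'I_m) : (lift ord0 i == ord0) = false by [].
have nl (O : {set 'I_m}) : ord0 \notin [set lift ord0 i | i in O].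
  by apply/imsetP => -[i _ /eqP]; rewrite eq_sym l0.
have il (O : {set 'I_m}) i : (lift ord0 i \in [set lift ord0 i | i in O]) = (i \in O).
  by rewrite mem_imset //; apply: lift_inj.
rewrite (bigID (fun O : {set _} => ord0 \in O)) /=; congr (_ + _).
  rewrite (reindex_onto (fun O : {set 'I_m} => ord0 |: [set lift ord0 i | i in O])
    (fun O => [set i | lift ord0 i \in O])) /=.
    apply: eq_bigl => O; rewrite setU11 /=; apply/eqP/setP => i.
    by rewrite inE in_setU1 l0 il.
  move=> O O0; apply/setP => i; rewrite in_setU1; case: (unliftP ord0 i) => [j ->|->].
    by rewrite l0 il inE.
  by rewrite eqxx O0.
rewrite (reindex_onto (fun O : {set 'I_m} => [set lift ord0 i | i in O])
  (fun O => [set i | lift ord0 i \in O])) /=.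
  apply: eq_bigl => O; rewrite nl /=; apply/eqP/setP => i.
  by rewrite inE il.
move=> O O0; apply/setP => i; case: (unliftP ord0 i) => [j ->|->].
  by rewrite il inE.
by rewrite (negbTE O0) (negbTE (nl _)).
Qed.

Lemma sum_subsets (u : seq A) (G : seq A -> R) : submono G ->
  \sum_(O : {set 'I_(size u)}) p ^+ #|O| * (1 - p) ^+ (size u - #|O|) * G (picked O) =
  expect p u G.
Proof.
elim: u G => [|a u IH] G mG /=.
  rewrite (bigD1 (finset.set0 : {set 'I_0})) //= big1 => [|O].
    by rewrite cards0 !expr0 !mul1r addr0 /picked enum_set0.
  by case/negP; apply/eqP/setP => -[].
have memG (O : {set 'I_(size u)}) :
    [seq nth x0 (a :: u) (val i) | i <- enum [set lift ord0 i | i in O]] =i picked O.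
  move=> e; apply/mapP/mapP => -[i iO ->]; rewrite ?mem_enum in iO.
    by case/imsetP: iO => j jO ->; exists j; rewrite ?mem_enum.
  by exists (lift ord0 i) => //; rewrite mem_enum imset_f.
rewrite big_set_ordS -!(IH (fun g => G (a :: g))); last exact: submono_cons.
rewrite -(IH G) // !mulr_sumr; congr (_ + _); apply: eq_bigr => O _.
  rewrite cardsU1 (_ : ord0 \notin _) ?add1n; last first.
    by apply/imsetP => -[i _ /eqP].
  rewrite card_imset ?subSS ?exprS; last exact: lift_inj.
  rewrite !mulrA; congr (_ * _); apply: submono_eq => // e.
  rewrite inE -memG; apply/mapP/orP => [[i]|].
    rewrite mem_enum in_setU1 => /predU1P[->|iO] ->; first by left.
    by right; apply: map_f; rewrite mem_enum.
  case=> [/eqP ->|/mapP[i]]; first by exists ord0; rewrite // mem_enum setU11.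
  by rewrite mem_enum => iO ->; exists i; rewrite // mem_enum in_setU1 iO orbT.
rewrite card_imset; last exact: lift_inj.
rewrite subSn; last by rewrite -[leqRHS]card_ord max_card.
rewrite exprS [_ * (_ * _)]mulrCA !mulrA; congr (_ * _).
exact: (submono_eq mG (memG O)).
Qed.

End SubsetSum.

Definition ends (e : pt * pt) : {fset pt} := [fset e.1; e.2]%fset.

Lemma ends_eq (e q : pt * pt) : ends e = ends q -> same_edge e q.
Proof.
case: e q => a b [c d]; rewrite /ends /= => E.
have ha x : (x == a) || (x == b) = (x == c) || (x == d).
  by rewrite -!in_fset2 E.
rewrite /same_edge /= !xpair_eqE.
have := ha a; have := ha b; have := ha c; have := ha d; rewrite !eqxx ?orbT /=.
move=> /orP[]/eqP -> /orP[]/eqP ->; rewrite ?eqxx ?orbT ?andbT ?orbb //=.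
  by rewrite (eq_sym a) => /esym ->.
by move=> _ /esym; rewrite eq_sym => ->.
Qed.

(** Rules out degenerate edges, which [mult_le] does not cover. *)
Lemma mult_refl n a : mult n a a = 0%N.
Proof.
elim: n a => [|n IH] a; last by rewrite multS !IH.
apply/eqP; rewrite eqn0Ngt -has_count; apply/hasPn => -[q r] qr.
have qr' : q != r by move: qr; rewrite !inE => /or3P[]/eqP[-> ->].
by apply: contraNN qr' => /orP[]/eqP[-> ->].
Qed.

Lemma count_ends n e : (count_mem e (map ends (face_edges n unit_face)) <= 2)%N.
Proof.
have [/mapP[[a b] eab ->]|ne] := boolP (e \in map ends (face_edges n unit_face)); last first.
  by rewrite (count_memPn ne).
have ab : a != b.
  apply/eqP => ab; rewrite -ab in eab.
  have /eqP := mult_refl n a; apply/negP; rewrite -lt0n -has_count; apply/hasP.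
  by exists (a, a); rewrite // /same_edge eqxx.
rewrite count_map; apply: (@leq_trans (mult n a b)).
  by apply: sub_count => q /= /eqP/esym/ends_eq.
by apply: leq_trans (mult_le n ab) _; rewrite /max_mult; case: ifP => //; case: ifP.
Qed.

Lemma faces_subfaces n : faces n = subfaces midpt centroid n unit_face.
Proof. by elim: n => // n IH; rewrite subfacesS -IH. Qed.

Lemma edges_face_edges n : edges n = undup (map ends (face_edges n unit_face)).
Proof.
rewrite /edges faces_subfaces bary_edgesE map_flatten -map_comp.
by congr (undup (flatten _)); apply: eq_map => -[[x y] z].
Qed.

Definition joins (S : seq {fset pt}) (a b : pt) := [fset a; b]%fset \in S.

Lemma path_conn (g : seq (pt * pt)) x s :
  path (joins (map ends g)) x s -> conn g x (last x s).
Proof.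
elim: s x => [|y s IH] x /=; first by move=> _; apply: conn_refl.
case/andP=> /mapP[[a b] abg E] /IH; apply: conn_trans.
have /orP[/eqP[<- <-]|/eqP[<- <-]] := @ends_eq (x, y) (a, b) E; first exact: conn1.
by apply: conn_sym; apply: conn1.
Qed.

Lemma conn_path (g : seq (pt * pt)) x y :
  conn g x y -> exists s, path (joins (map ends g)) x s && (last x s == y).
Proof.
elim=> [a|a b c ab _ [s bs]]; first by exists [::]; rewrite /= eqxx.
exists (b :: s); rewrite /= -andbA; apply/andP; split => //.
case/orP: ab => [/(map_f ends)|/(map_f ends)]; first by [].
by rewrite /joins /ends /= fsetUC.
Qed.

(** * The lower bound on crossing probabilities *)

Section Crossing.
Variable R : realType.

Lemma le_asbool (P Q : Prop) : (P -> Q) -> (asbool P)%:R <= (asbool Q)%:R :> R.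
Proof.
move=> PQ; rewrite ler_nat; case: (asboolP P) => // /PQ Q1.
by rewrite asboolT.
Qed.

Definition crosses (S : seq {fset pt}) : R :=
  (asbool (exists s, path (joins S) v0 s && (last (v0 : pt) s == v1)))%:R.

Lemma crosses_submono : submono crosses.
Proof.
move=> S S' SS'; apply: le_asbool => -[s /andP[ps ls]]; exists s; rewrite ls andbT.
by apply: sub_path ps => a b; apply: SS'.
Qed.

Lemma crossprobE n (p : R) : crossprob n p = expect p (edges n) crosses.
Proof.
rewrite -(sum_subsets fset0 p _ crosses_submono); apply: eq_bigr => O _.
congr (_ * _); rewrite /crosses; congr (nat_of_bool (asbool _))%:R.
apply: eq_exists => s; congr (is_true (_ && _)); apply: eq_path => a b.
rewrite /adj /joins; apply/existsP/mapP => [[i /andP[iO /eqP E]]|[i]].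
  by exists i; rewrite ?mem_enum.
by rewrite mem_enum => iO E; exists i; rewrite iO E eqxx.
Qed.

(** [edges n] is the list of sides stripped of orientation and repetitions, each edge occurring at
    most twice, so [expect_undup] compares the two models. *)
Lemma crossprob_ge n (p : R) : (3 <= n)%N -> 1 - (1 - side R) ^+ 2 <= p -> p <= 1 ->
  wt R 1 <= wt R unit_mass * crossprob n p.
Proof.
move=> n3 sp p1.
pose G (g : seq (pt * pt)) : R := (asbool (conn g (v0 : pt) v1))%:R.
have GE g : crosses (map ends g) = G g.
  rewrite /crosses /G; congr (nat_of_bool _)%:R; apply/asbool_equiv_eq; split.
    by case=> s /andP[/path_conn + /eqP <-].
  exact: conn_path.
have mG : mono G.
  split=> [g|g h gh]; first exact: ler0n.
  by apply: le_asbool; apply: le_conn_conn.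
have G1 g : conn g (v0 : pt) v1 -> 1 <= G g by move=> c; rewrite /G asboolT.
apply: le_trans (expect_conn_ge (v2 : pt) n3 mG G1) _.
rewrite ler_wpM2l ?wt_ge0 // crossprobE edges_face_edges.
apply: le_trans (expect_undup (side0 R) (side1 R) sp p1 (count_ends n) crosses_submono).
by rewrite expect_map; apply: (expect_le (side0 R) (side1 R)) => g; rewrite GE.
Qed.

End Crossing.

Theorem theorem4p3 (R : realType) : pT R < 282 / 1000.
Proof.
pose q : R := 1 - (1 - side R) ^+ 2.
have q282 : q < 282 / 1000 by rewrite /q /side; lra.
apply: le_lt_trans q282; rewrite /pT; set S := [set _ | _]%classic.
(* Above [q] the crossing probability is at least [d] from the third level on, so it cannot tend to
   0. *)
have ubS : ubound S q.
  move=> p [/andP[p0 p1] cvg0]; rewrite leNgt; apply/negP => qp.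
  have M0 := unit_mass_gt0 R.
  pose d := wt R 1 / wt R unit_mass.
  have d0 : 0 < d by apply: divr_gt0; apply: wt_gt0.
  have /= [N _ HN] := cvgr_lt 0 cvg0 d d0.
  have := HN (maxn N 3) (leq_maxl _ _) => /=.
  rewrite /d ltNge ler_pdivrMr // mulrC => /negP; apply.
  exact: crossprob_ge (leq_maxr _ _) (ltW qp) p1.
(* The supremum of the empty set is 0 by convention, which is also at most [q]. *)
have [S0|/set0P S0] := eqVneq S set0; last by apply: ge_sup.
by rewrite S0 sup0 /q /side; lra.
Qed.
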